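(* Let $A\in\mathcal L(\mathcal G)$ be an $M$-hyponormal operator for some $M>0$, let $B\in\mathcal L(\mathcal K)$ be a dominant operator, let $T\in\mathcal L(\mathcal H)$, and let $W_1\in\mathcal L(\mathcal G,\mathcal H)$ and $W_2\in\mathcal L(\mathcal H,\mathcal K)$ be nonzero operators such that $W_1A^*=TW_1$ and $W_2T=BW_2$. If $T\neq\lambda I$ for every $\lambda\in\mathbb C$, then $T$ has a nontrivial hyperinvariant subspace.
   Context: All spaces are complex separable Hilbert spaces. An operator $A$ is $M$-hyponormal if $\|(A-\lambda)^*x\|\le M^{1/2}\|(A-\lambda)x\|$ for every $\lambda\in\mathbb C$ and every vector $x$. An operator $B$ is dominant if for every $\lambda\in\mathbb C$ there is a constant $M_\lambda$ with $\|(B-\lambda)^*x\|\le M_\lambda^{1/2}\|(B-\lambda)x\|$ for every $x$. A closed subspace is hyperinvariant for $T$ if it is invariant under every operator commuting with $T$; nontrivial means different from $\{0\}$ and $\mathcal H$. *)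

(* Defs.v *)
From HB Require Import structures.
From mathcomp Require Import all_boot all_order all_algebra.
From mathcomp Require Import complex.
From mathcomp Require Import reals.
Set Implicit Arguments. Unset Strict Implicit. Unset Printing Implicit Defensive.
Import Order.TTheory GRing.Theory Num.Theory.
Local Open Scope ring_scope.

Section Hilbert.
Variable R : realType.
Local Notation C := (R[i]).

Section OneSpace.
Variables (V : lmodType C) (ip : V -> V -> C).

Definition is_inner_product : Prop :=
  [/\ (forall x y z, ip (x + y) z = ip x z + ip y z),
      (forall (a : C) x y, ip (a *: x) y = a * ip x y),
      (forall x y, ip y x = Num.conj (ip x y)),
      (forall x, 0 <= ip x x) &
      (forall x, ip x x = 0 -> x = 0)].

Definition hnorm (x : V) : R := Num.sqrt (complex.Re (ip x x)).

Definition hcomplete : Prop :=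
  forall u : nat -> V,
    (forall e : R, 0 < e -> exists N : nat, forall m n : nat,
        (N <= m)%N -> (N <= n)%N -> hnorm (u m - u n) < e) ->
    exists l : V, forall e : R, 0 < e -> exists N : nat, forall n : nat,
        (N <= n)%N -> hnorm (u n - l) < e.

Definition hseparable : Prop :=
  exists d : nat -> V, forall (x : V) (e : R), 0 < e ->
    exists n : nat, hnorm (x - d n) < e.

Definition is_hilbert : Prop :=
  [/\ is_inner_product, hcomplete & hseparable].

Definition closed_subspace (S : V -> Prop) : Prop :=
  [/\ S 0,
      (forall (a : C) x y, S x -> S y -> S (a *: x + y)) &
      (forall (u : nat -> V) (l : V), (forall n, S (u n)) ->
         (forall e : R, 0 < e -> exists N : nat, forall n : nat,
            (N <= n)%N -> hnorm (u n - l) < e) -> S l)].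

Definition nontrivial_subspace (S : V -> Prop) : Prop :=
  (exists x, S x /\ x <> 0) /\ (exists x, ~ S x).
End OneSpace.

Definition bounded_op (V W : lmodType C) (ipV : V -> V -> C) (ipW : W -> W -> C)
  (f : V -> W) : Prop :=
  (forall (a : C) x y, f (a *: x + y) = a *: f x + f y) /\
  (exists c : R, forall x, hnorm ipW (f x) <= c * hnorm ipV x).

Definition is_adjoint (V W : lmodType C) (ipV : V -> V -> C) (ipW : W -> W -> C)
  (f : V -> W) (fs : W -> V) : Prop :=
  forall x y, ipW (f x) y = ipV x (fs y).

(* A is M-hyponormal: ||(A - lam)^* x|| <= M^{1/2} ||(A - lam) x||,
   using (A - lam)^* = A^* - conj lam *)
Definition M_hyponormal (V : lmodType C) (ip : V -> V -> C) (A : V -> V) (M : R)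
  : Prop :=
  forall As : V -> V, is_adjoint ip ip A As ->
  forall (lam : C) (x : V),
    hnorm ip (As x - Num.conj lam *: x) <= Num.sqrt M * hnorm ip (A x - lam *: x).

Definition dominant (V : lmodType C) (ip : V -> V -> C) (B : V -> V) : Prop :=
  forall Bs : V -> V, is_adjoint ip ip B Bs ->
  forall lam : C, exists Ml : R, forall x : V,
    hnorm ip (Bs x - Num.conj lam *: x) <= Num.sqrt Ml * hnorm ip (B x - lam *: x).

Definition hyperinvariant (V : lmodType C) (ip : V -> V -> C) (T : V -> V)
  (S : V -> Prop) : Prop :=
  closed_subspace ip S /\
  forall X : V -> V, bounded_op ip ip X -> (forall x, X (T x) = T (X x)) ->
    forall x, S x -> S (X x).

End Hilbert.

(* Main.v *)
(** Write [D'] for the adjoint of [D].  For [X] commuting with [T] the operator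
[Y = W2 X W1] is an intertwiner: [Y A' = B Y].  If all of them vanish, the closed span of
the vectors [X W1 g] is hyperinvariant and contained in [ker W2].  Otherwise fix
[Y <> 0].  The self-commutator [S = A' A - A A'] satisfies
[|<S x, x>| <= (1 + M) |(A - z) x|^2] for every [z], so [S x = (A - z)' c] with [c]
bounded locally in [z], and [Y S x = (B - conj z) Y c].  For dominant [B] a vector with
such a local resolvent on the whole plane is zero (Stampfli-Wadhwa, through Liouville's
theorem), so [Y S = 0].  Hence the orthogonal complement of [ker Y] reduces [A] and [A]
is normal there; call [N] the part of [A'].  If [N] is a scalar, [T] has an eigenvector.
If not, there are two nonzero separated spectral projections [E], [F] of the real part
of some [w N], [|w| = 1], and [Y E], [Y1 F] have orthogonal ranges for all intertwiners
[Y], [Y1]: by dominance, [F Y1' Y E g] lies in the range of [(N - z)'] for every [z].  A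
vector with this property vanishes: its spectral measure is [o(area)] on squares
shrinking to a point, whereas bisection would produce such squares with measure at
least a constant times the area. *)

Require Import Defs.
From HB Require Import structures.
From mathcomp Require Import all_boot all_order all_algebra.
From mathcomp Require Import complex.
From mathcomp Require Import reals.
From mathcomp Require Import all_classical all_analysis.
From mathcomp Require Import ring lra.
Set Implicit Arguments. Unset Strict Implicit. Unset Printing Implicit Defensive.
Import Order.TTheory GRing.Theory Num.Theory numFieldNormedType.Exports.
Local Open Scope ring_scope.

(** * Goursat's theorem and Liouville's theorem *)

Section Bisection.
Variable R : realType.
Implicit Types (a c h k : R).

(** The dominance constant of [B] varies with [z] without local control, so it can be used at one
    [z] at a time only. Douglas' lemma turns it into a statement free of constants: the range of
    [B - z] lies in that of [(B - z)']. Local boundedness of [c], in contrast, rests on [M] being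
    the same for all [z]. The factor [1 + M] appears because translating [A] does not change the
    self-commutator, whence [<S x, x> = |(A - z) x|^2 - |(A - z)' x|^2].

    The orthogonality yields the subspace as follows. For [X] commuting with [T], all vectors
    [X W1 E g] are orthogonal to all [W2' Y F h]; since [Y E] and [Y F] are nonzero, the closed span
    of the former is neither zero nor the whole space. If [N] is a scalar on the complement of
    [ker Y], the relation [W1 A' = T W1] carries it to an eigenvalue of [T], whose eigenspace is
    hyperinvariant and, [T] not being scalar, proper.

    No spectral measure is constructed. Projections come from the absolute value of [S - c]; since
    they commute with everything that commutes with [S], those of the real and imaginary parts of a
    normal operator can be multiplied. *)

Lemma nested_halves (a : nat -> R) h : 0 <= h ->
  (forall n, a n.+1 = a n \/ a n.+1 = a n + h / 2 ^+ n.+1) ->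
  exists s, forall n, a n <= s <= a n + h / 2 ^+ n.
Proof.
move=> h0 step.
have hn0 n : 0 <= h / 2 ^+ n by rewrite divr_ge0 ?exprn_ge0.
have hS n : h / 2 ^+ n = h / 2 ^+ n.+1 + h / 2 ^+ n.+1.
  rewrite exprS; have : (2 ^+ n : R) != 0 by rewrite expf_neq0// pnatr_eq0.
  by move=> ?; field.
have up n : a n <= a n.+1.
  by case: (step n) => ->//; have := hn0 n.+1; lra.
have dn n : a n.+1 + h / 2 ^+ n.+1 <= a n + h / 2 ^+ n.
  by rewrite (hS n); case: (step n) => ->; have := hn0 n.+1; lra.
have mono : {homo a : m n / (m <= n)%N >-> m <= n} by apply: homo_leq => //; exact: le_trans.
have dmono m n : (m <= n)%N -> a n + h / 2 ^+ n <= a m + h / 2 ^+ m.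
  elim: n => [|n IH]; first by rewrite leqn0 => /eqP->.
  rewrite leq_eqVlt => /orP[/eqP->//|]; rewrite ltnS => /IH; exact: le_trans.
have ab m n : a m <= a n + h / 2 ^+ n.
  case/orP: (leq_total m n) => mn.
    by apply: (le_trans (mono _ _ mn)); rewrite lerDl.
  by apply: (le_trans _ (dmono _ _ mn)); rewrite lerDl.
exists (sup (range a)) => n; apply/andP; split.
  apply: ub_le_sup; last by exists n.
  by exists (a 0%N + h / 2 ^+ 0) => _ [m _ <-].
apply: ge_sup; first by exists (a 0%N), 0%N.
by move=> _ [m _ <-].
Qed.

(** Serves both Goursat's theorem and the shrinking spectral squares of a normal operator. The
    property depends on the level [n] because in both cases the threshold shrinks by a factor 4 at
    each step. *)
Lemma bisection (bad : nat -> R -> R -> Prop) (a0 c0 h k : R) :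
  0 <= h -> 0 <= k -> bad 0%N a0 c0 ->
  (forall n a c, bad n a c -> exists a' c',
     [/\ bad n.+1 a' c', a' = a \/ a' = a + h / 2 ^+ n.+1 &
                         c' = c \/ c' = c + k / 2 ^+ n.+1]) ->
  exists s t, forall n, exists a c, [/\ bad n a c,
     a <= s <= a + h / 2 ^+ n & c <= t <= c + k / 2 ^+ n].
Proof.
move=> h0 k0 bad0 step.
have /choice[f Hf] : forall x : nat * (R * R), exists y : R * R,
  bad x.1 x.2.1 x.2.2 -> [/\ bad x.1.+1 y.1 y.2,
     y.1 = x.2.1 \/ y.1 = x.2.1 + h / 2 ^+ x.1.+1 &
     y.2 = x.2.2 \/ y.2 = x.2.2 + k / 2 ^+ x.1.+1].
  move=> [n [a c]] /=; have [b|nb] := pselect (bad n a c); last by exists (a, c).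
  by have [a' [c' H]] := step _ _ _ b; exists (a', c').
pose u := fix u n := if n is m.+1 then f (m, u m) else (a0, c0).
have bu n : bad n (u n).1 (u n).2.
  by elim: n => //= n IH; case: (Hf (n, u n) IH).
have [s Hs] := @nested_halves (fun n => (u n).1) h h0 (fun n =>
  let: And3 _ H _ := Hf (n, u n) (bu n) in H).
have [t Ht] := @nested_halves (fun n => (u n).2) k k0 (fun n =>
  let: And3 _ _ H := Hf (n, u n) (bu n) in H).
by exists s, t => n; exists (u n).1, (u n).2.
Qed.

Lemma halves_small h e : 0 < e -> exists n, `|h| / 2 ^+ n < e.
Proof.
move=> e0; exists (Num.truncn (`|h| / e)).+1.
rewrite ltr_pdivrMr ?exprn_gt0// mulrC -ltr_pdivrMr//.
apply: (lt_trans (truncnS_gt _)).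
by rewrite -natrX ltr_nat ltn_expl.
Qed.

End Bisection.

(** * Antiderivatives of continuous functions on a bounded interval *)

Section Antiderivative.
Variable R : realType.
Implicit Types (f g : R -> R).

Definition econtinuous f := forall x e, 0 < e -> exists2 d, 0 < d &
  forall y, `|y - x| < d -> `|f y - f x| <= e.

Lemma econtinuous_continuous f : econtinuous f -> continuous f.
Proof.
move=> cf x; apply/cvgrPdist_le => e e0.
have [d d0 H] := cf x e e0.
by apply/nbhs_ballP; exists d => //= y; rewrite /ball/= distrC => /H; rewrite distrC.
Qed.

Lemma is_derive_eps f (x l e : R) : is_derive x 1 f l -> 0 < e ->
  exists2 d, 0 < d & forall y, `|y - x| < d ->
    `|f y - f x - l * (y - x)| <= e * `|y - x|.
Proof.
move=> /is_derive1_caratheodory[g [fg cg <-]] e0.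
move/cvgrPdist_le : cg => /(_ e e0) /nbhs_ballP[d /= d0 H].
exists d => // y yd; rewrite fg -mulrBl normrM ler_wpM2r// distrC.
by apply: H; rewrite /ball/= distrC.
Qed.

Lemma antiderivative_exists (L : R) f : econtinuous f ->
  exists F, forall x, - L < x < L -> is_derive x 1 F (f x).
Proof.
move=> /econtinuous_continuous cf.
have intf : lebesgue_measure.-integrable `[- L, L] (EFin \o f).
  apply: continuous_compact_integrable; first exact: segment_compact.
  exact: continuous_subspaceT.
exists (fun x => \int[lebesgue_measure]_(t in `[- L, x]) (f t))%R => x /andP[Lx xL].
have [] := continuous_FTC1_closed xL intf Lx (cf x).
move=> d1 d2; apply: (DeriveDef d1); rewrite -derive1E; exact: d2.
Qed.

Lemma mean_value_near (F f : R -> R) (a b k e : R) : a <= b ->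
  (forall x, a <= x <= b -> is_derive x 1 F (f x)) ->
  (forall x, a <= x <= b -> `|f x - k| <= e) ->
  `|F b - F a - k * (b - a)| <= e * (b - a).
Proof.
move=> ab dF H; have [||c cab E] := @MVT_segment R F f a b ab.
- by move=> x xab; apply: dF; rewrite !(itvP xab).
- apply: derivable_within_continuous => x xab.
  by have [] := dF x; [rewrite !(itvP xab)|].
- rewrite E -mulrBl normrM (ger0_norm (x := b - a)) ?subr_ge0//.
  by rewrite ler_wpM2r ?subr_ge0// H// !(itvP cab).
Qed.

Variable L : R.

(** One antiderivative is chosen on the whole interval from [-L] to [L], so that [integ] is a
    difference of two of its values and additivity over adjacent intervals is a ring identity. The
    value [cst 0] for other [f] is a default that makes the function total. *)
Definition antiderivative f : R -> R :=
  if pselect (econtinuous f) is left cf then projT1 (cid (antiderivative_exists L cf))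
  else cst 0.

Lemma is_derive_antiderivative f x : econtinuous f -> - L < x < L ->
  is_derive x 1 (antiderivative f) (f x).
Proof.
rewrite /antiderivative => cf xL; case: pselect => // cf'.
exact: (projT2 (cid (antiderivative_exists L cf'))) xL.
Qed.

Definition integ f a b := antiderivative f b - antiderivative f a.

(** Stated for two functions because the chosen antiderivatives need not be additive in [f]. It
    compares the integrals over opposite sides of a rectangle. *)
Lemma integB_near f g a b k e : econtinuous f -> econtinuous g ->
  - L < a -> a <= b -> b < L ->
  (forall x, a <= x <= b -> `|f x - g x - k| <= e) ->
  `|integ f a b - integ g a b - k * (b - a)| <= e * (b - a).
Proof.
move=> cf cg La ab bL H.
have -> : integ f a b - integ g a b =
  (antiderivative f \- antiderivative g) b - (antiderivative f \- antiderivative g) a.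
  by rewrite /integ /=; ring.
apply: (@mean_value_near _ (fun x => f x - g x)) => // x /andP[ax xb].
have xL : - L < x < L by rewrite (lt_le_trans La ax) (le_lt_trans xb bL).
by apply: is_deriveB; exact: is_derive_antiderivative.
Qed.

Lemma integ_near f a b k e : econtinuous f -> - L < a -> a <= b -> b < L ->
  (forall x, a <= x <= b -> `|f x - k| <= e) ->
  `|integ f a b - k * (b - a)| <= e * (b - a).
Proof.
move=> cf La ab bL H; apply: (@mean_value_near _ f) => // x /andP[ax xb].
apply: is_derive_antiderivative => //.
by rewrite (lt_le_trans La ax) (le_lt_trans xb bL).
Qed.

Lemma integ_cat f a b c : integ f a c = integ f a b + integ f b c.
Proof. by rewrite /integ; ring. Qed.

End Antiderivative.

(** * Goursat's theorem on rectangles *)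

Section Goursat.
Variable R : realType.
Variables p q : R -> R -> R.

(* The differential of [p + i q] at [(s, t)] is multiplication by [al + i be]. *)
Hypothesis hol : forall s t, exists al be, forall e, 0 < e ->
  exists2 d, 0 < d & forall s' t', `|s' - s| < d -> `|t' - t| < d ->
    `|p s' t' - p s t - (al * (s' - s) - be * (t' - t))| <= e * (`|s' - s| + `|t' - t|) /\
    `|q s' t' - q s t - (be * (s' - s) + al * (t' - t))| <= e * (`|s' - s| + `|t' - t|).

Let cont s t e : 0 < e -> exists2 d, 0 < d & forall s' t', `|s' - s| < d -> `|t' - t| < d ->
    `|p s' t' - p s t| <= e /\ `|q s' t' - q s t| <= e.
Proof.
move=> e0; have [al [be /(_ 1 ltr01)[d d0 H]]] := hol s t.
pose m := 2 + `|al| + `|be|.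
have m0 : 0 < m by rewrite /m; have := normr_ge0 al; have := normr_ge0 be; lra.
exists (Num.min d (e / m / 2)).
  by rewrite lt_min d0 !divr_gt0.
move=> s' t'; rewrite !lt_min => /andP[sd se] /andP[td te].
have [] := H s' t' sd td; rewrite mul1r.
have am x y : `|x * y| = `|x| * `|y| by exact: normrM.
have key (x u v P : R) : `|P - (u * (s' - s) + v * (t' - t))| <= `|s' - s| + `|t' - t| ->
   `|u| + `|v| <= `|al| + `|be| -> `|P| <= e.
  move=> PH uv.
  have : `|P| <= `|s' - s| + `|t' - t| + (`|u| * `|s' - s| + `|v| * `|t' - t|).
    have -> : P = (P - (u * (s' - s) + v * (t' - t))) + (u * (s' - s) + v * (t' - t)) by ring.
    apply: (le_trans (ler_normD _ _)); apply: lerD => //.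
    by apply: (le_trans (ler_normD _ _)); rewrite !normrM.
  move/le_trans; apply.
  have <- : m * (e / m / 2) + m * (e / m / 2) = e by field; rewrite gt_eqF.
  have : `|u| * `|s' - s| <= `|u| * (e / m / 2) by rewrite ler_wpM2l// ltW.
  have : `|v| * `|t' - t| <= `|v| * (e / m / 2) by rewrite ler_wpM2l// ltW.
  have : (`|u| + `|v|) * (e / m / 2) <= (`|al| + `|be|) * (e / m / 2).
    by rewrite ler_wpM2r// ltW// !divr_gt0.
  have : 0 <= (`|al| + `|be|) * (e / m / 2).
    by rewrite mulr_ge0 ?addr_ge0// ltW// !divr_gt0.
  have : 0 < e / m / 2 by rewrite !divr_gt0.
  rewrite /m; move: se te; set k := e / _ / 2 => *; lra.
move=> Hp Hq; split.
- by apply: (key 0 al (- be)); rewrite ?normrN// mulNr.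
- by apply: (key 0 be al) => //; rewrite addrC.
Qed.

Let cp1 t : econtinuous (p^~ t).
Proof.
move=> s e e0; have [d d0 H] := cont s t e0; exists d => // y yd.
by have [] := H y t yd; rewrite ?subrr ?normr0.
Qed.
Let cp2 s : econtinuous (p s).
Proof.
move=> t e e0; have [d d0 H] := cont s t e0; exists d => // y yd.
by have [] := H s y; rewrite ?subrr ?normr0.
Qed.
Let cq1 t : econtinuous (q^~ t).
Proof.
move=> s e e0; have [d d0 H] := cont s t e0; exists d => // y yd.
by have [] := H y t yd; rewrite ?subrr ?normr0.
Qed.

Variable L : R.
Notation I := (integ L).

(* The imaginary part of the integral of [(p + i q) (ds + i dt)] along the
   boundary of [[a, b] x [c, d]]. *)
Definition boundary a b c d :=
  I (q^~ c) a b + I (p b) c d - I (q^~ d) a b - I (p a) c d.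

Lemma boundary_quarter a b c d m n : boundary a b c d =
  boundary a m c n + boundary m b c n + boundary a m n d + boundary m b n d.
Proof.
rewrite /boundary (integ_cat _ (q^~ c) a m b) (integ_cat _ (q^~ d) a m b).
by rewrite (integ_cat _ (p b) c n d) (integ_cat _ (p a) c n d); ring.
Qed.

(** The affine part of [p + i q] at [(s, t)] contributes [al * (c - d) * (b - a)] from the
    horizontal sides and [al * (b - a) * (d - c)] from the vertical ones, and these cancel. What
    remains is the remainder of the expansion, of order [e] times the size of the rectangle,
    integrated over sides of that size. The differential is used with [e / 2] since each comparison
    of two boundary points passes through [(s, t)]. *)
Lemma boundary_local s t e : 0 < e -> exists2 r, 0 < r &
  forall a b c d, - L < a -> a <= s -> s <= b -> b < L ->
    - L < c -> c <= t -> t <= d -> d < L -> b - a < r -> d - c < r ->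
    `|boundary a b c d| <= e * (b - a + (d - c)) * (b - a + (d - c)).
Proof.
move=> e0; have [al [be /(_ (e / 2))[|r r0 H]]] := hol s t; first by rewrite divr_gt0.
exists r => // a b c d La as_ sb bL Lc ct td dL bar dcr.
have dist (x y u v : R) : u <= x -> x <= v -> u <= y -> y <= v -> `|x - y| <= v - u.
  by move=> *; rewrite ler_norml; apply/andP; split; lra.
have near2 (f : R -> R -> R) (u v : R) (x1 x2 y1 y2 : R) :
   (forall x y, `|x - s| < r -> `|y - t| < r -> `|f x y - f s t - (u * (x - s) + v * (y - t))|
      <= e / 2 * (`|x - s| + `|y - t|)) ->
   a <= x1 <= b -> a <= x2 <= b -> c <= y1 <= d -> c <= y2 <= d ->
   `|f x1 y1 - f x2 y2 - (u * (x1 - x2) + v * (y1 - y2))| <= e * (b - a + (d - c)).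
  move=> Hf /andP[? ?] /andP[? ?] /andP[? ?] /andP[? ?].
  have x1s : `|x1 - s| <= b - a by apply: dist.
  have x2s : `|x2 - s| <= b - a by apply: dist.
  have y1t : `|y1 - t| <= d - c by apply: dist.
  have y2t : `|y2 - t| <= d - c by apply: dist.
  have h1 := Hf x1 y1 (le_lt_trans x1s bar) (le_lt_trans y1t dcr).
  have h2 := Hf x2 y2 (le_lt_trans x2s bar) (le_lt_trans y2t dcr).
  have -> : f x1 y1 - f x2 y2 - (u * (x1 - x2) + v * (y1 - y2)) =
    (f x1 y1 - f s t - (u * (x1 - s) + v * (y1 - t))) -
    (f x2 y2 - f s t - (u * (x2 - s) + v * (y2 - t))) by ring.
  apply: (le_trans (ler_normB _ _)); nra.
have ab : a <= b by exact: le_trans sb.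
have cd : c <= d by exact: le_trans td.
have i1 : `|I (q^~ c) a b - I (q^~ d) a b - (al * (c - d)) * (b - a)|
     <= e * (b - a + (d - c)) * (b - a).
  apply: integB_near => // x xab.
  have := near2 q be al x x c d; rewrite subrr mulr0 add0r; apply => //.
  - by move=> x' y' h1 h2; have [] := H x' y' h1 h2.
  - by rewrite lexx.
  - by rewrite lexx andbT.
have i2 : `|I (p b) c d - I (p a) c d - (al * (b - a)) * (d - c)|
     <= e * (b - a + (d - c)) * (d - c).
  apply: integB_near => // x xab.
  have := near2 p al (- be) b a x x; rewrite subrr mulr0 addr0; apply => //.
  - by move=> x' y' h1 h2; have [] := H x' y' h1 h2; rewrite mulNr.
  - by rewrite lexx andbT.
  - by rewrite lexx.
rewrite mulrDr.
have -> : boundary a b c d = (I (q^~ c) a b - I (q^~ d) a b - (al * (c - d)) * (b - a)) +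
  (I (p b) c d - I (p a) c d - (al * (b - a)) * (d - c)) by rewrite /boundary; ring.
by apply: (le_trans (ler_normD _ _)); exact: lerD.
Qed.

Theorem goursat a b c d : - L < a -> a <= b -> b < L ->
  - L < c -> c <= d -> d < L -> boundary a b c d = 0.
Proof.
move=> La ab bL Lc cd dL; apply/eqP/negPn/negP => nz.
set m := `|boundary a b c d|.
have m0 : 0 < m by rewrite normr_gt0.
set h := b - a; set k := d - c.
have h0 : 0 <= h by rewrite subr_ge0.
have k0 : 0 <= k by rewrite subr_ge0.
pose bad n x y := [/\ a <= x, x + h / 2 ^+ n <= b, c <= y, y + k / 2 ^+ n <= d &
  m / 4 ^+ n <= `|boundary x (x + h / 2 ^+ n) y (y + k / 2 ^+ n)|].
have half (u : R) n : u / 2 ^+ n = u / 2 ^+ n.+1 + u / 2 ^+ n.+1.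
  rewrite exprS; have : (2 ^+ n : R) != 0 by rewrite expf_neq0// pnatr_eq0.
  by move=> ?; field.
have quarter n : m / 4 ^+ n = 4 * (m / 4 ^+ n.+1).
  rewrite exprS; have : (4 ^+ n : R) != 0 by rewrite expf_neq0// pnatr_eq0.
  by move=> ?; field.
have [|n x y|s [t st]] := @bisection R bad a c h k h0 k0.
- by rewrite /bad expr0 !divr1 /h /k ![_ + (_ - _)]addrC !subrK !lexx; split.
- move=> [ax xb cy yd]; rewrite quarter (half h n) (half k n) !addrA.
  have hn : 0 <= h / 2 ^+ n.+1 by rewrite divr_ge0 ?exprn_ge0.
  have kn : 0 <= k / 2 ^+ n.+1 by rewrite divr_ge0 ?exprn_ge0.
  move: xb yd; rewrite (half h n) (half k n) !addrA.
  rewrite (@boundary_quarter x _ y _ (x + h / 2 ^+ n.+1) (y + k / 2 ^+ n.+1)).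
  set u := h / 2 ^+ n.+1 in hn *; set v := k / 2 ^+ n.+1 in kn *.
  set x' := x + u; set y' := y + v => xb yd.
  set A := boundary _ _ _ _; set B := boundary _ _ _ _; set C := boundary _ _ _ _.
  set D := boundary _ _ _ _ => sum4.
  have : [\/ m / 4 ^+ n.+1 <= `|A|, m / 4 ^+ n.+1 <= `|B|, m / 4 ^+ n.+1 <= `|C| |
            m / 4 ^+ n.+1 <= `|D| ].
    have := le_trans sum4 (ler_normD _ _).
    have := ler_normD (A + B) C; have := ler_normD A B.
    have [?|?] := leP (m / 4 ^+ n.+1) `|A|; first by constructor 1.
    have [?|?] := leP (m / 4 ^+ n.+1) `|B|; first by constructor 2.
    have [?|?] := leP (m / 4 ^+ n.+1) `|C|; first by constructor 3.
    have [?|?] := leP (m / 4 ^+ n.+1) `|D|; first by constructor 4.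
    by move=> *; exfalso; lra.
  have xb' : x + u <= b by apply: le_trans xb; rewrite lerDl.
  have yd' : y + v <= d by apply: le_trans yd; rewrite lerDl.
  have ax' : a <= x' by apply: (le_trans ax); rewrite lerDl.
  have cy' : c <= y' by apply: (le_trans cy); rewrite lerDl.
  case=> ?; [exists x, y|exists x', y|exists x, y'|exists x', y'];
    (split; [by [] | by [left|right] | by [left|right]]).
- have hk0 : 0 <= (h + k) * (h + k) := mulr_ge0 (addr_ge0 h0 k0) (addr_ge0 h0 k0).
  (* With this constant the local bound at level [n] stays below [m / 4 ^+ n], contradicting [bad].
     The summand 1 keeps the denominator positive when the rectangle is a point. *)
  have e0 : 0 < m / (2 * ((h + k) * (h + k) + 1)).
    by apply: divr_gt0 => //; apply: mulr_gt0 => //; apply: ltr_wpDl.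
  have [r r0 Hr] := boundary_local s t e0.
  have [n] := halves_small (h + k) r0.
  rewrite (ger0_norm (addr_ge0 h0 k0)) => nr.
  have [x [y [[ax xb cy yd] big /andP[xs sx] /andP[yt ty]]]] := st n.
  have hn : 0 <= h / 2 ^+ n by rewrite divr_ge0 ?exprn_ge0.
  have kn : 0 <= k / 2 ^+ n by rewrite divr_ge0 ?exprn_ge0.
  have := Hr x (x + h / 2 ^+ n) y (y + k / 2 ^+ n).
  rewrite ![_ + _ - _]addrC !addKr.
  move=> /(_ (lt_le_trans La ax) xs sx (le_lt_trans xb bL) (lt_le_trans Lc cy) yt ty
             (le_lt_trans yd dL)) small.
  have := le_trans big (small _ _); rewrite leNgt => /(_ _ _)/negP; apply; try lra.
  rewrite -mulrDl (_ : 4 = 2 * 2) ?exprMn; last by ring.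
  set z := 2 ^+ n; have z0 : 0 < z by rewrite /z exprn_gt0.
  set w := (h + k) * (h + k) + 1.
  have w0 : (h + k) * (h + k) < w by rewrite /w; lra.
  have ww : 0 < w := le_lt_trans hk0 w0.
  have -> : m / (2 * w) * ((h + k) / z) * ((h + k) / z) =
     m / (z * z) * ((h + k) * (h + k) / (2 * w)) by field; rewrite !gt_eqF.
  rewrite -[X in _ < X]mulr1 ltr_pM2l ?divr_gt0 ?mulr_gt0//.
  by rewrite ltr_pdivrMr ?mulr_gt0// mul1r; lra.
Qed.

End Goursat.

(** * The modulus of a complex number *)

Section Modulus.
Variable R : rcfType.
Local Notation C := R[i].
Implicit Types x y z : C.

(** The modulus as an element of [R]; the norm on [R[i]] takes its values in [R[i]] itself. *)
Definition cabs (z : C) : R := Num.sqrt (complex.Re z ^+ 2 + complex.Im z ^+ 2).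

Lemma cabs_normc z : cabs z = Normc.normc z.
Proof. by case: z. Qed.

Lemma cabsM x y : cabs (x * y) = cabs x * cabs y.
Proof. by rewrite !cabs_normc Normc.normcM. Qed.

Lemma cabsD x y : cabs (x + y) <= cabs x + cabs y.
Proof. by rewrite !cabs_normc; exact: complex.le_normcD. Qed.

Lemma cabsN x : cabs (- x) = cabs x.
Proof. by rewrite !cabs_normc; exact: complex.normcN. Qed.

Lemma cabs_ge0 x : 0 <= cabs x. Proof. exact: sqrtr_ge0. Qed.

Lemma sqr_cabs x : cabs x ^+ 2 = complex.Re x ^+ 2 + complex.Im x ^+ 2.
Proof. by rewrite sqr_sqrtr// addr_ge0// sqr_ge0. Qed.

Lemma Re_le_cabs x : `|complex.Re x| <= cabs x.
Proof.
rewrite -(ler_pXn2r (n := 2)) ?nnegrE ?cabs_ge0 ?normr_ge0//.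
by rewrite sqr_cabs real_normK ?num_real// lerDl sqr_ge0.
Qed.

Lemma Im_le_cabs x : `|complex.Im x| <= cabs x.
Proof.
rewrite -(ler_pXn2r (n := 2)) ?nnegrE ?cabs_ge0 ?normr_ge0//.
by rewrite sqr_cabs real_normK ?num_real// lerDr sqr_ge0.
Qed.

Lemma cabs_le_ReIm x : cabs x <= `|complex.Re x| + `|complex.Im x|.
Proof.
rewrite -(ler_pXn2r (n := 2)) ?nnegrE ?cabs_ge0 ?addr_ge0//.
rewrite sqr_cabs sqrrD !real_normK ?num_real//.
by rewrite addrAC lerDl mulrn_wge0// mulr_ge0.
Qed.

End Modulus.

(** * Liouville's theorem for entire functions vanishing at infinity *)

Section Liouville.
Variable R : realType.
Local Notation C := R[i].

Definition entire (phi : C -> C) := forall z, exists l, forall e, 0 < e ->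
  exists2 d, 0 < d & forall w, cabs (w - z) < d ->
    cabs (phi w - phi z - l * (w - z)) <= e * cabs (w - z).

Definition cexp (s t : R) : C := Complex (expR s * cos t) (expR s * sin t).

Lemma cexpD s t h k : cexp (s + h) (t + k) = cexp s t * cexp h k.
Proof.
rewrite /cexp; apply/eqP; rewrite eq_complex /= expRD cosD sinD.
by apply/andP; split; apply/eqP; ring.
Qed.

Lemma cabs_cexp s t : cabs (cexp s t) = expR s.
Proof.
rewrite /cabs /= !exprMn -mulrDr cos2Dsin2 mulr1 sqrtr_sqr.
by rewrite ger0_norm// expR_ge0.
Qed.

Lemma cexp_eps e : 0 < e -> exists2 d, 0 < d & forall h k, `|h| < d -> `|k| < d ->
  cabs (cexp h k - 1 - Complex h k) <= e * (`|h| + `|k|).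
Proof.
move=> e0; pose e' := Num.min 1 (e / 8).
have e'0 : 0 < e' by rewrite lt_min ltr01 divr_gt0.
have e'1 : e' <= 1 by rewrite ge_min lexx.
have e'e : e' <= e / 8 by rewrite ge_min lexx orbT.
have [d1 d10 H1] := is_derive_eps (is_derive_expR (0 : R)) e'0.
have [d2 d20 H2] := is_derive_eps (is_derive_cos (0 : R)) e'0.
have [d3 d30 H3] := is_derive_eps (is_derive_sin (0 : R)) e'0.
exists (Num.min (Num.min d1 d2) (Num.min d3 (e' / 2))).
  by rewrite !lt_min d10 d20 d30 divr_gt0.
move=> h k; rewrite !lt_min => /andP[/andP[hd1 hd2] /andP[hd3 hd4]].
move=> /andP[/andP[kd1 kd2] /andP[kd3 kd4]].
have := H1 h; rewrite subr0 expR0 mul1r => /(_ hd1) E1.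
have := H2 k; rewrite subr0 cos0 sin0 oppr0 mul0r subr0 => /(_ kd2) E2.
have := H3 k; rewrite subr0 sin0 cos0 mul1r subr0 => /(_ kd3) E3.
have E4 : `|expR h - 1| <= 2 * `|h|.
  have -> : expR h - 1 = (expR h - 1 - h) + h by ring.
  apply: (le_trans (ler_normD _ _)).
  have : e' * `|h| <= 1 * `|h| by rewrite ler_wpM2r.
  by lra.
have E5 : `|expR h| <= 2.
  have -> : expR h = (expR h - 1) + 1 by ring.
  apply: (le_trans (ler_normD _ _)); rewrite normr1; lra.
apply: (le_trans (cabs_le_ReIm _)).
have -> : complex.Re (cexp h k - 1 - Complex h k) =
  expR h * (cos k - 1) + (expR h - 1 - h) by rewrite /=; ring.
have -> : complex.Im (cexp h k - 1 - Complex h k) =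
  expR h * (sin k - k) + (expR h - 1) * k by rewrite /=; ring.
have F1 : `|expR h * (cos k - 1)| <= 2 * (e' * `|k|) by rewrite normrM ler_pM.
have F2 : `|expR h * (sin k - k)| <= 2 * (e' * `|k|) by rewrite normrM ler_pM.
have F3 : `|(expR h - 1) * k| <= e' * `|k|.
  rewrite normrM ler_wpM2r//; lra.
apply: (le_trans (lerD (ler_normD _ _) (ler_normD _ _))).
have : e' * `|k| <= e / 8 * `|k| by rewrite ler_wpM2r.
have : e' * `|h| <= e / 8 * `|h| by rewrite ler_wpM2r.
have : 0 <= e * `|h| by rewrite mulr_ge0// ltW.
have : 0 <= e * `|k| by rewrite mulr_ge0// ltW.
by lra.
Qed.

(** The chain rule for [phi (z0 + exp (s + i t))]. In these logarithmic coordinates an annulus about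
    [z0] becomes a rectangle, so Goursat's theorem on rectangles applies to it. *)
Lemma entire_cexp phi z0 : entire phi -> forall s t, exists l, forall e, 0 < e ->
  exists2 d, 0 < d & forall s' t', `|s' - s| < d -> `|t' - t| < d ->
    cabs (phi (z0 + cexp s' t') - phi (z0 + cexp s t) - l * Complex (s' - s) (t' - t))
      <= e * (`|s' - s| + `|t' - t|).
Proof.
move=> ent s t; have [l Hl] := ent (z0 + cexp s t).
exists (l * cexp s t) => e e0.
set E := cexp s t.
have EE : cabs E = expR s by rewrite /E cabs_cexp.
have E0 : 0 < expR s by rewrite expR_gt0.
have e1 : 0 < e / (expR s * 4) by rewrite divr_gt0 ?mulr_gt0.
have [d1 d10 H1] := Hl _ e1.
pose m := cabs l * expR s + 1.
have m0 : 0 < m by rewrite /m ltr_wpDl// mulr_ge0 ?cabs_ge0// ltW.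
pose e2 := Num.min 1 (e / m / 2).
have e20 : 0 < e2 by rewrite lt_min ltr01 !divr_gt0.
have [d2 d20 H2] := cexp_eps e20.
exists (Num.min d2 (d1 / (expR s * 4) / 2)).
  by rewrite lt_min d20 !divr_gt0// mulr_gt0.
move=> s' t'; rewrite !lt_min => /andP[h1 h2] /andP[k1 k2].
set h := s' - s in h1 h2 *; set k := t' - t in k1 k2 *.
have := H2 h k h1 k1; set D := cexp h k - 1 - Complex h k => HD.
have -> : cexp s' t' = E * cexp h k by rewrite /E -cexpD /h /k !subrKC.
set w := z0 + E * cexp h k.
have wz : w - (z0 + E) = E * (D + Complex h k) by rewrite /w /D; ring.
set a := `|h| + `|k|.
have a0 : 0 <= a by rewrite addr_ge0.
have hk : cabs (Complex h k) <= a by exact: cabs_le_ReIm.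
have De2 : e2 * a <= a by rewrite ler_piMl// ge_min lexx.
have wzb : cabs (w - (z0 + E)) <= expR s * (2 * a).
  rewrite wz cabsM EE ler_wpM2l ?(ltW E0)//.
  by apply: (le_trans (cabsD _ _)); rewrite mulr_natl mulr2n lerD// (le_trans HD).
have -> : phi w - phi (z0 + E) - l * E * Complex h k =
  (phi w - phi (z0 + E) - l * (w - (z0 + E))) + l * E * D by rewrite wz; ring.
apply: (le_trans (cabsD _ _)).
have small : cabs (w - (z0 + E)) < d1.
  apply: (le_lt_trans wzb); rewrite /a.
  have : expR s * (2 * (`|h| + `|k|)) < expR s * (2 * (d1 / (expR s * 4) / 2 * 2)).
    by rewrite !ltr_pM2l//; lra.
  move/lt_le_trans; apply; rewrite le_eqVlt; apply/orP; right.
  have -> : expR s * (2 * (d1 / (expR s * 4) / 2 * 2)) = d1 / 2.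
    by field; rewrite gt_eqF.
  by lra.
have := H1 w small => /le_trans/(_ (ler_wpM2l (ltW e1) wzb)) P1.
have P1' : e / (expR s * 4) * (expR s * (2 * a)) = e / 2 * a by field; rewrite gt_eqF.
have P2 : cabs (l * E * D) <= m * (e / m / 2 * a).
  rewrite 2!cabsM EE ler_pM ?mulr_ge0 ?cabs_ge0 ?(ltW E0)//; first by rewrite /m lerDl.
  by apply: (le_trans HD); rewrite ler_wpM2r// ge_min lexx orbT.
have P2' : m * (e / m / 2 * a) = e / 2 * a by field; rewrite gt_eqF.
rewrite {}P1' in P1; rewrite {}P2' in P2.
apply: (le_trans (lerD P1 P2)); lra.
Qed.

(** On a rectangle of height [2 pi] in logarithmic coordinates the horizontal sides cancel by
    periodicity, so Goursat's theorem says that the mean of the real part of [phi] over a circle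
    about [z0] does not depend on the radius. Small circles give nearly [Re (phi z0)], large ones
    nearly 0. Only the real part appears because [boundary] is one component of the contour
    integral. *)
Lemma liouville_Re phi z0 : entire phi ->
  (forall e, 0 < e -> exists r, forall z, r <= cabs z -> cabs (phi z) <= e) ->
  complex.Re (phi z0) = 0.
Proof.
move=> ent vanish; apply/eqP/negPn/negP => nz.
set e := `|complex.Re (phi z0)| / 3.
have e0 : 0 < e by rewrite divr_gt0 ?normr_gt0.
have [r Hr] := vanish e e0.
have [l Hl] := ent z0.
have [d d0 Hd] := Hl 1 ltr01.
(* On the circle of radius [d'] the first-order expansion keeps [phi] within
   [d' * (cabs l + 1) <= e] of [phi z0]. The bounds [d' <= 1 <= r'] give [s1 <= 0 <= s2]. *)
pose d' := Num.min 1 (Num.min (d / 2) (e / (cabs l + 1))).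
have l0 := cabs_ge0 l.
have l1 : 0 < cabs l + 1 by lra.
have d'0 : 0 < d'.
  by rewrite !lt_min ltr01 (divr_gt0 d0 (ltr0Sn _ 1)) (divr_gt0 e0 l1).
pose s1 := ln d'.
pose r' := 1 + `|r| + cabs z0.
have r'1 : 1 <= r' by rewrite /r' -addrA lerDl addr_ge0 ?cabs_ge0.
pose s2 := ln r'.
have s10 : s1 <= 0 by rewrite /s1 ln_le0// ge_min lexx.
have s20 : 0 <= s2 by rewrite /s2 ln_ge0.
pose p s t := complex.Re (phi (z0 + cexp s t)).
pose q s t := complex.Im (phi (z0 + cexp s t)).
have hol s t : exists al be, forall e, 0 < e ->
  exists2 d, 0 < d & forall s' t', `|s' - s| < d -> `|t' - t| < d ->
    `|p s' t' - p s t - (al * (s' - s) - be * (t' - t))| <= e * (`|s' - s| + `|t' - t|) /\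
    `|q s' t' - q s t - (be * (s' - s) + al * (t' - t))| <= e * (`|s' - s| + `|t' - t|).
  have [L HL] := entire_cexp z0 ent s t.
  exists (complex.Re L), (complex.Im L) => e1 e10; have [d1 d10 H] := HL e1 e10.
  exists d1 => // s' t' h1 h2; have {}H := H s' t' h1 h2; split; apply: le_trans H.
    apply: le_trans (Re_le_cabs _); rewrite /p le_eqVlt; apply/orP; left; apply/eqP; congr `|_|.
    by case: L {HL} => u v; case: (phi _) => ? ?; case: (phi _) => ? ? /=.
  apply: le_trans (Im_le_cabs _); rewrite /q le_eqVlt; apply/orP; left; apply/eqP; congr `|_|.
  by case: L {HL} => u v; case: (phi _) => ? ?; case: (phi _) => ? ? /=; ring.
have pi2 : pi *+ 2 < 8 :> R by rewrite mulr2n; have := @pihalf_lt2 R; lra.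
have pi0 : 0 < pi *+ 2 :> R by rewrite mulrn_wgt0// pi_gt0.
(* Large enough for both sides of the rectangle: [s1 <= 0 <= s2] and [2 pi < 8]. *)
pose L := 8 + (s2 - s1).
have := @goursat R p q hol L s1 s2 0 (pi *+ 2).
rewrite /boundary.
have -> : q^~ (pi *+ 2) = q^~ 0.
  by apply/funext => s; rewrite /q /cexp -[pi *+ 2]add0r cosD2pi sinD2pi.
have -> : integ L (q^~ 0) s1 s2 + integ L (p s2) 0 (pi *+ 2) - integ L (q^~ 0) s1 s2 -
   integ L (p s1) 0 (pi *+ 2) = integ L (p s2) 0 (pi *+ 2) - integ L (p s1) 0 (pi *+ 2).
  by ring.
move=> eqI.
have cp s : econtinuous (p s).
  have [al [be H]] := hol s 0.
  move=> t e1 e10; have [L' HL'] := entire_cexp z0 ent s t.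
  have [d1 d10 Hd1] := HL' 1 ltr01.
  have L'0 := cabs_ge0 L'.
  have L'1 : 0 < cabs L' + 1 by lra.
  exists (Num.min d1 (e1 / (cabs L' + 1))); first by rewrite lt_min d10 divr_gt0.
  move=> y; rewrite lt_min => /andP[yd ye].
  have := Hd1 s y; rewrite subrr normr0 => /(_ d10 yd); rewrite mul1r add0r => Hy.
  have -> : p s y - p s t = complex.Re (phi (z0 + cexp s y) - phi (z0 + cexp s t)).
    by rewrite /p; case: (phi _) => ? ?; case: (phi _) => ? ?.
  apply: (le_trans (Re_le_cabs _)).
  set D := (phi _ - phi _) in Hy *.
  have DE : D = (D - L' * Complex 0 (y - t)) + L' * Complex 0 (y - t) by rewrite subrK.
  rewrite DE; apply: (le_trans (cabsD _ _)); rewrite cabsM.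
  have -> : cabs (Complex 0 (y - t)) = `|y - t|.
    by rewrite /cabs /= expr0n /= add0r sqrtr_sqr.
  move: ye; rewrite ltr_pdivlMr// => ye; lra.
have eqI' : integ L (p s2) 0 (pi *+ 2) = integ L (p s1) 0 (pi *+ 2).
  by apply/eqP; rewrite -subr_eq0; apply/eqP; apply: eqI; rewrite /L; lra.
have big t : `|p s2 t - 0| <= e.
  rewrite subr0; apply: (le_trans (Re_le_cabs _)); apply: Hr.
  have : cabs (cexp s2 t) <= cabs (z0 + cexp s2 t) + cabs (- z0).
    by rewrite -{1}[cexp s2 t](addKr z0) addrC cabsD.
  rewrite cabsN cabs_cexp /s2 lnK ?posrE; last by lra.
  rewrite /r'; have := ler_norm r; lra.
have small t : `|p s1 t - complex.Re (phi z0)| <= e.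
  have -> : p s1 t - complex.Re (phi z0) = complex.Re (phi (z0 + cexp s1 t) - phi z0).
    by rewrite /p; case: (phi _) => ? ?; case: (phi _) => ? ?.
  apply: (le_trans (Re_le_cabs _)).
  have := Hd (z0 + cexp s1 t); rewrite [z0 + _]addrC addrK cabs_cexp /s1 lnK ?posrE//.
  have d'd : d' < d by apply: (@le_lt_trans _ _ (d / 2)); [rewrite !ge_min lexx ?orbT|lra].
  move=> /(_ d'd); rewrite mul1r => H.
  set D := phi _ - _ in H *.
  have -> : D = (D - l * cexp (ln d') t) + l * cexp (ln d') t by ring.
  apply: (le_trans (cabsD _ _)); rewrite cabsM cabs_cexp lnK ?posrE//.
  apply: (@le_trans _ _ (d' * (cabs l + 1))); first by lra.
  by rewrite -ler_pdivlMr// !ge_min lexx !orbT.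
have b1 := @integ_near R L (p s2) 0 (pi *+ 2) 0 e (cp s2).
have b2 := @integ_near R L (p s1) 0 (pi *+ 2) _ e (cp s1).
have {}b1 := b1 _ (ltW pi0) _ (fun x _ => big x).
have {}b2 := b2 _ _ (ltW pi0) _ (fun x _ => small x).
have L1 : - L < 0 by rewrite /L; lra.
have L2 : pi *+ 2 < L by rewrite /L; lra.
move: (b1 L1 L2) (b2 L1 L2); rewrite eqI' mul0r subr0 subr0.
set X := integ _ _ _ _; set P := pi *+ 2 in pi0 *.
move=> B1 B2.
have : `|complex.Re (phi z0) * P| <= e * P + e * P.
  have -> : complex.Re (phi z0) * P = X - (X - complex.Re (phi z0) * P) by ring.
  by apply: (le_trans (ler_normB _ _)); exact: lerD.
rewrite normrM (gtr0_norm pi0) -mulrDl ler_pM2r//.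
have : 0 < `|complex.Re (phi z0)| by rewrite normr_gt0.
by rewrite /e; lra.
Qed.

Lemma liouville phi : entire phi ->
  (forall e, 0 < e -> exists r, forall z, r <= cabs z -> cabs (phi z) <= e) ->
  forall z, phi z = 0.
Proof.
move=> ent vanish z; have R0 := liouville_Re z ent vanish.
have ci : cabs (Complex 0 1 : C) = 1 by rewrite /cabs /= expr0n expr1n add0r sqrtr1.
have := @liouville_Re (fun z => Complex 0 1 * phi z) z.
have -> : complex.Re (Complex 0 1 * phi z) = - complex.Im (phi z).
  by case: (phi z) => a b /=; ring.
move=> I0; apply/eqP; rewrite eq_complex R0 eqxx /= -oppr_eq0; apply/eqP; apply: I0.
- move=> w; have [l Hl] := ent w; exists (Complex 0 1 * l) => e e0.
  have [d d0 H] := Hl e e0; exists d => // w' /H.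
  by rewrite -mulrA -!mulrBr cabsM ci mul1r.
- move=> e e0; have [r Hr] := vanish e e0; exists r => w /Hr.
  by rewrite cabsM ci mul1r.
Qed.

End Liouville.
Local Open Scope complex_scope.

(** * Hilbert spaces and bounded operators *)

Record hilbert (R : realType) := Hilbert {
  carrier :> lmodType R[i];
  hip : carrier -> carrier -> R[i];
  hilbertP : is_hilbert hip }.

Section HilbertTheory.
Variables (R : realType) (V : hilbert R).
Implicit Types (x y : V) (z : R[i]) (a : R).

(** The real part determines the norm and, since scalars can be moved across it by conjugation, also
    the adjoints of complex linear maps. Its values lie in an ordered field, where [ring] and [lra]
    are available. *)
Definition rp x y : R := complex.Re (hip x y).
Definition nm x : R := hnorm (@hip R V) x.

Lemma conjE z : Num.conj z = Complex (complex.Re z) (- complex.Im z).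
Proof. by case: z. Qed.

Lemma rpDl x y x' : rp (x + x') y = rp x y + rp x' y.
Proof.
have [[D _ _ _ _] _ _] := hilbertP V; rewrite /rp D.
by case: (hip x y) => ? ?; case: (hip x' y).
Qed.

Lemma rpC x y : rp x y = rp y x.
Proof.
have [[_ _ C _ _] _ _] := hilbertP V; rewrite /rp (C y x).
by case: (hip y x).
Qed.

Lemma rpDr x y y' : rp x (y + y') = rp x y + rp x y'.
Proof. by rewrite rpC rpDl !(rpC x). Qed.

Lemma rpZl z x y :
  rp (z *: x) y = complex.Re z * rp x y + complex.Im z * rp (Complex 0 1 *: x) y.
Proof.
have [[_ Z _ _ _] _ _] := hilbertP V; rewrite /rp !Z.
by case: (hip x y) => p q; case: z => s t /=; ring.
Qed.

Lemma rpZZ z x y : rp (z *: x) y = rp x (Num.conj z *: y).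
Proof.
have [[_ Z C _ _] _ _] := hilbertP V; rewrite /rp Z (C (Num.conj z *: y)) Z.
rewrite (C x y) !conjE /=.
by case: (hip x y) => p q; case: z => s t /=; ring.
Qed.

Lemma rpRl a x y : rp (a%:C *: x) y = a * rp x y.
Proof. by rewrite rpZl /= mul0r addr0. Qed.

Lemma rpRr a x y : rp x (a%:C *: y) = a * rp x y.
Proof. by rewrite rpC rpRl rpC. Qed.

Lemma scaleN1 x : - x = (-1)%:C *: x.
Proof. by rewrite rmorphN1 scaleN1r. Qed.

Lemma rpNl x y : rp (- x) y = - rp x y.
Proof. by rewrite scaleN1 rpRl mulN1r. Qed.

Lemma rpNr x y : rp x (- y) = - rp x y.
Proof. by rewrite rpC rpNl rpC. Qed.

Lemma rp0l y : rp 0 y = 0.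
Proof. by rewrite -(scale0r (0 : V)) (rpRl 0) mul0r. Qed.

Lemma rp0r y : rp y 0 = 0.
Proof. by rewrite rpC rp0l. Qed.

Definition rpE := (rp0l, rp0r, rpDl, rpDr, rpNl, rpNr, rpRl, rpRr).

Lemma rp_ge0 x : 0 <= rp x x.
Proof.
have [[_ _ _ P _] _ _] := hilbertP V; rewrite /rp.
by move: (P x); rewrite lecE => /andP[].
Qed.

Lemma rp_eq0 x : rp x x = 0 -> x = 0.
Proof.
have [[_ _ _ P P0] _ _] := hilbertP V; rewrite /rp => r0; apply: P0.
move: (P x); rewrite lecE => /andP[/eqP i0 _].
by apply/eqP; rewrite eq_complex r0 i0 !eqxx.
Qed.

Lemma rp_ext x y : (forall u, rp u x = rp u y) -> x = y.
Proof.
move=> H; apply/eqP; rewrite -subr_eq0; apply/eqP/rp_eq0.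
by rewrite rpDr rpNr H subrr.
Qed.

Lemma nm_ge0 x : 0 <= nm x. Proof. exact: sqrtr_ge0. Qed.

Lemma nm2 x : nm x * nm x = rp x x.
Proof. by rewrite -expr2 sqr_sqrtr// rp_ge0. Qed.

Lemma nm_le x a : 0 <= a -> rp x x <= a * a -> nm x <= a.
Proof. by move=> a0; rewrite -nm2 -!expr2 ler_pXn2r ?nnegrE ?nm_ge0. Qed.

Lemma nm_eq0 x : nm x = 0 -> x = 0.
Proof. by move=> x0; apply: rp_eq0; rewrite -nm2 x0 mulr0. Qed.

Lemma nm0 : nm 0 = 0.
Proof. by apply/eqP; rewrite -[_ == _]orbb -mulf_eq0 nm2 rp0l. Qed.

Lemma nm_gt0 x : x <> 0 -> 0 < nm x.
Proof. by move=> x0; rewrite lt_neqAle nm_ge0 eq_sym andbT; apply/eqP => /nm_eq0. Qed.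

Lemma cauchy_schwarz x y : rp x y <= nm x * nm y.
Proof.
have [->|/eqP x0] := eqVneq x 0; first by rewrite rp0l nm0 mul0r.
have [->|/eqP y0] := eqVneq y 0; first by rewrite rp0r nm0 mulr0.
have nx := nm_gt0 x0; have ny := nm_gt0 y0.
have := rp_ge0 ((nm y)%:C *: x - (nm x)%:C *: y).
rewrite !rpE -!nm2 (rpC y x) => H.
have : 0 <= 2 * (nm x * nm y) * (nm x * nm y - rp x y) by move: H; congr (_ <= _); ring.
by rewrite pmulr_rge0 ?subr_ge0// !mulr_gt0.
Qed.

Lemma abs_cauchy_schwarz x y : `|rp x y| <= nm x * nm y.
Proof.
rewrite ler_norml cauchy_schwarz andbT lerNl -rpNl.
by apply: (le_trans (cauchy_schwarz _ _)); rewrite {1}/nm /hnorm -/(rp _ _) rpNl rpNr opprK.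
Qed.

Lemma nmN x : nm (- x) = nm x.
Proof. by rewrite /nm /hnorm -!/(rp _ _) rpNl rpNr opprK. Qed.

Lemma nmD x y : nm (x + y) <= nm x + nm y.
Proof.
apply: nm_le; first by rewrite addr_ge0 ?nm_ge0.
rewrite !rpE (rpC y x) -!nm2; have := cauchy_schwarz x y; lra.
Qed.

Lemma nmB x y : nm (x - y) <= nm x + nm y.
Proof. by rewrite -(nmN y) nmD. Qed.

Lemma nm_distC x y : nm (x - y) = nm (y - x).
Proof. by rewrite -nmN opprB. Qed.

Lemma rpcc z x : rp (z *: x) (z *: x) = cabs z ^+ 2 * rp x x.
Proof.
rewrite rpZZ scalerA rpC rpZl sqr_cabs conjE.
by case: z => s t /=; ring.
Qed.

Lemma nmZ z x : nm (z *: x) = cabs z * nm x.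
Proof.
rewrite {1}/nm /hnorm -/(rp _ _) rpcc sqrtrM ?sqr_ge0//.
by rewrite sqrtr_sqr ger0_norm ?cabs_ge0.
Qed.

Lemma cabs_real a : cabs a%:C = `|a|.
Proof. by rewrite /cabs /= expr0n addr0 sqrtr_sqr. Qed.

Definition tends (u : nat -> V) (l : V) := forall e, 0 < e ->
  exists N, forall n, (N <= n)%N -> nm (u n - l) < e.

Lemma hilbert_complete (u : nat -> V) :
  (forall e, 0 < e -> exists N, forall m n, (N <= m)%N -> (N <= n)%N -> nm (u m - u n) < e) ->
  exists l, tends u l.
Proof. by have [_ C _] := hilbertP V; exact: C. Qed.

Lemma small_eq0 (c k : R) : 0 <= c -> (forall e, 0 < e -> c <= k * e) -> c = 0.
Proof.
move=> c0 H; apply/eqP; rewrite eq_le c0 andbT leNgt; apply/negP => cp.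
have k0 : 0 < `|k| + 1 by rewrite ltr_wpDl.
have e0 : 0 < c / (`|k| + 1) / 2 by rewrite !divr_gt0.
have := H _ e0.
have : k * (c / (`|k| + 1) / 2) <= (`|k| + 1) * (c / (`|k| + 1) / 2).
  by rewrite ler_pM2r//; have := ler_norm k; lra.
have -> : (`|k| + 1) * (c / (`|k| + 1) / 2) = c / 2 by field; rewrite gt_eqF.
lra.
Qed.

Lemma small_le (a b k : R) : (forall e, 0 < e -> a <= b + k * e) -> a <= b.
Proof.
move=> H; rewrite leNgt; apply/negP => ba.
have c0 : 0 <= a - b by rewrite subr_ge0 ltW.
have := @small_eq0 (a - b) k c0; move=> /(_ _)/eqP; rewrite subr_eq0 gt_eqF// => F.
by have // : false by apply: F => e /H; lra.
Qed.

End HilbertTheory.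

Arguments rp {R V}.
Arguments nm {R V}.

(* [w] is the limit of [j u] along a minimizing sequence of [|j u|^2 - 2 l u]. *)
Lemma riesz_range (R : realType) (V : hilbert R) (U : lmodType R[i]) (j : {linear U -> V})
    (l : U -> R) (c : R) : 0 <= c ->
  (forall u v, l (u + v) = l u + l v) -> (forall a u, l (a%:C *: u) = a * l u) ->
  (forall u, l u <= c * nm (j u)) ->
  exists w, [/\ forall e, 0 < e -> exists u, nm (w - j u) < e, nm w <= c &
                forall u, rp (j u) w = l u].
Proof.
move=> c0 lD lZ lc.
pose J u := rp (j u) (j u) - 2 * l u.
have Jge u : - (c * c) <= J u.
  have := lc u; rewrite /J -nm2 => H.
  have := sqr_ge0 (nm (j u) - c); rewrite sqrrB; lra.
pose S : set R := fun r => exists u, J u = r.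
have infS : has_inf S.
  by split; [exists (J 0), 0|exists (- (c * c)) => _ [u <-]].
pose m := inf S.
have mJ u : m <= J u by apply: (ge_inf infS.2); exists u.
have approx e : 0 < e -> exists u, J u < m + e.
  by move=> e0; have [_ [u <-] H] := inf_adherent e0 infS; exists u.
(* The parallelogram law, with [m <= J] at the midpoint of [u] and [v]. *)
have near u v e : J u < m + e -> J v < m + e -> nm (j u - j v) * nm (j u - j v) <= 4 * e.
  move=> Hu Hv; have := mJ ((1/2)%:C *: (u + v)).
  rewrite nm2 /J lZ lD linearZ linearD !rpE; move: Hu Hv; rewrite /J (rpC (j v) (j u)); lra.
have /choice[u Hu] : forall n, exists u, J u < m + n.+1%:R^-1.
  by move=> n; apply: approx; rewrite invr_gt0 ltr0Sn.
have inv_small (e : R) : 0 < e -> exists N, forall n, (N <= n)%N -> n.+1%:R^-1 < e :> R.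
  move=> e0; exists (Num.truncn e^-1) => n Nn.
  rewrite invf_plt ?posrE ?ltr0Sn//.
  by apply: (lt_le_trans (truncnS_gt _)); rewrite ler_nat ltnS.
have [|w Hw] := @hilbert_complete R V (fun n => j (u n)).
  move=> e e0; have [|N HN] := inv_small (e * e / 8); first by rewrite !divr_gt0 ?mulr_gt0.
  exists N => p q Np Nq.
  have hp : J (u p) < m + e * e / 8 by apply: (lt_trans (Hu p)); rewrite ltrD2l HN.
  have hq : J (u q) < m + e * e / 8 by apply: (lt_trans (Hu q)); rewrite ltrD2l HN.
  have := near _ _ _ hp hq; set d := nm _ => H.
  have d0 : 0 <= d by exact: nm_ge0.
  rewrite ltNge; apply/negP => ed.
  have : e * e <= d * d by apply: ler_pM => //; exact: ltW.
  have : 0 < e * e by rewrite mulr_gt0.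
  lra.
have dense e : 0 < e -> exists2 v, nm (w - j v) < e & J v < m + e.
  move=> e0; have [N1 H1] := Hw e e0; have [N2 H2] := inv_small e e0.
  exists (u (maxn N1 N2)); first by rewrite nm_distC H1// leq_maxl.
  by apply: (lt_trans (Hu _)); rewrite ltrD2l H2// leq_maxr.
have first v : rp (j v) w = l v.
  set D := rp (j v) w - l v.
  have key t : - (t * t * rp (j v) (j v)) <= 2 * t * D.
    apply: (@small_le _ _ _ (1 + 2 * `|t| * nm (j v))) => e e0.
    have [v' v'w Jv'] := dense e e0.
    have := mJ (v' + t%:C *: v).
    rewrite /J lD lZ linearD linearZ !rpE => H1.
    have H2 : `|rp (j v) (w - j v')| <= nm (j v) * e.
      by apply: (le_trans (abs_cauchy_schwarz _ _)); rewrite ler_wpM2l ?nm_ge0// ltW.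
    have H3 : t * rp (j v) (w - j v') >= - (`|t| * (nm (j v) * e)).
      rewrite lerNl -mulNr; apply: (le_trans (ler_norm _)).
      by rewrite normrM normrN ler_wpM2l.
    move: H3 Jv'; rewrite /J /D rpDr rpNr (rpC (j v') (j v)) in H1 *.
    lra.
  have D0 : D * D = 0.
    have b0 := rp_ge0 (j v); set b := rp (j v) (j v) in b0 key *.
    (* Nearly the minimizer [- D / b] of [t * t * b + 2 * t * D]; the added 1 avoids division by
       zero. *)
    have := key (- D / (b + 1)).
    have b1 : b + 1 != 0 by rewrite gt_eqF// ltr_wpDl.
    have -> : - (- D / (b + 1) * (- D / (b + 1)) * b) = - (D * D * (b / ((b + 1) * (b + 1)))).
      by field.
    have -> : 2 * (- D / (b + 1)) * D = - (D * D * (2 * (b + 1) / ((b + 1) * (b + 1)))).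
      by field.
    rewrite lerN2 -subr_ge0 -mulrBr -mulrBl => H.
    have D2 : 0 <= D * D by rewrite -expr2 sqr_ge0.
    apply/eqP; rewrite eq_le D2 andbT.
    have : (b - 2 * (b + 1)) / ((b + 1) * (b + 1)) < 0.
      rewrite pmulr_llt0 ?invr_gt0 ?mulr_gt0 ?ltr_wpDl//; lra.
    by move=> neg; rewrite -(nmulr_lge0 _ neg).
  by apply/eqP; rewrite -subr_eq0; apply/eqP; move/eqP: D0; rewrite mulf_eq0 orbb => /eqP.
exists w; split => //.
  by move=> e /dense[v ? _]; exists v.
have [->|/eqP w0] := eqVneq w 0; first by rewrite nm0.
rewrite -(ler_pM2r (nm_gt0 w0)) nm2.
apply: (@small_le _ _ _ (nm w + c)) => e e0; have [v vw _] := dense e e0.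
have -> : rp w w = rp (w - j v) w + l v by rewrite -first rpDl rpNl subrK.
have h1 := cauchy_schwarz (w - j v) w.
have h2 : nm (w - j v) * nm w <= e * nm w by rewrite ler_wpM2r ?nm_ge0// ltW.
have h3 : nm (j v) <= nm w + nm (w - j v).
  by have := nmB w (w - j v); rewrite opprB addrC subrK.
have h4 : c * nm (j v) <= c * (nm w + e) by rewrite ler_wpM2l//; lra.
have := lc v; lra.
Qed.

Ltac vring := apply: rp_ext => ?; rewrite ?rpE; ring.

Record op (R : realType) (V W : hilbert R) := Op {
  opf :> V -> W;
  op_lin : linear opf;
  op_bnd : exists c : R, forall x, nm (opf x) <= c * nm x }.

HB.instance Definition _ (R : realType) (V W : hilbert R) (f : op V W) :=
  GRing.isLinear.Build R[i] V W *:%R (opf f) (op_lin f).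

(** * Bounded operators, adjoints, Douglas' lemma and kernel projections *)

Section Operators.
Variable R : realType.
Implicit Types (U V W : hilbert R) (z : R[i]).

Lemma rpZr V z (x y : V) : rp x (z *: y) = rp (Num.conj z *: x) y.
Proof. by rewrite rpZZ conjCK. Qed.

Lemma opfD V W (f : op V W) x y : f (x + y) = f x + f y.
Proof. exact: linearD. Qed.

Lemma opfB V W (f : op V W) x y : f (x - y) = f x - f y.
Proof. exact: linearB. Qed.

Lemma opfZ V W (f : op V W) z x : f (z *: x) = z *: f x.
Proof. exact: linearZ. Qed.

Lemma opf0 V W (f : op V W) : f 0 = 0.
Proof. exact: linear0. Qed.

Lemma op_bound V W (f : op V W) : exists2 c, 0 < c & forall x, nm (f x) <= c * nm x.
Proof.
have [c Hc] := op_bnd f; exists (`|c| + 1) => [|x]; first by rewrite ltr_wpDl.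
apply: (le_trans (Hc x)); rewrite ler_wpM2r ?nm_ge0//.
by have := ler_norm c; lra.
Qed.

Definition bounded_linear V W (f : V -> W) : Prop :=
  linear f /\ exists c : R, forall x, nm (f x) <= c * nm x.

Definition mkop V W (f : V -> W) (h : bounded_linear f) : op V W := Op h.1 h.2.

Lemma id_subproof V : bounded_linear (@id V).
Proof. by split => //; exists 1 => x; rewrite mul1r. Qed.
Definition op1 V : op V V := mkop (id_subproof V).

Lemma add_subproof V W (f g : op V W) : bounded_linear (fun x => f x + g x).
Proof.
split=> [a x y|]; first by rewrite !linearP scalerDr addrACA.
have [c _ Hc] := op_bound f; have [d _ Hd] := op_bound g.
exists (c + d) => x; apply: (le_trans (nmD _ _)); rewrite mulrDl; exact: lerD.
Qed.
Definition opD V W (f g : op V W) : op V W := mkop (add_subproof f g).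

Lemma scale_subproof V W z (f : op V W) : bounded_linear (fun x => z *: f x).
Proof.
split=> [a x y|]; first by rewrite linearP scalerDr !scalerA mulrC.
have [c _ Hc] := op_bound f; exists (cabs z * c) => x.
by rewrite nmZ -mulrA ler_wpM2l ?cabs_ge0.
Qed.
Definition opZ V W z (f : op V W) : op V W := mkop (scale_subproof z f).

Lemma comp_subproof U V W (f : op V W) (g : op U V) : bounded_linear (fun x => f (g x)).
Proof.
split=> [a x y|]; first by rewrite !linearP.
have [c c0 Hc] := op_bound f; have [d _ Hd] := op_bound g.
by exists (c * d) => x; apply: (le_trans (Hc _)); rewrite -mulrA ler_wpM2l// ltW.
Qed.
Definition opM U V W (f : op V W) (g : op U V) : op U W := mkop (comp_subproof f g).

Definition opN V W (f : op V W) : op V W := opZ (-1) f.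
Definition opB V W (f g : op V W) : op V W := opD f (opN g).

Lemma opBE V W (f g : op V W) x : opB f g x = f x - g x.
Proof. by rewrite /= scaleN1r. Qed.

Definition shift V (f : op V V) z : op V V := opD f (opZ (- z) (op1 V)).

Lemma shiftE V (f : op V V) z x : shift f z x = f x - z *: x.
Proof. by rewrite /= scaleNr. Qed.

Lemma adjoint_exists V W (f : op V W) : {g : op W V | forall x y, rp (f x) y = rp x (g y)}.
Proof.
apply: cid; have [c c0 Hc] := op_bound f.
have /choice[g Hg] : forall y, exists w, nm w <= c * nm y /\ forall x, rp x w = rp (f x) y.
  move=> y; have [||||w [_ H1 H2]] := @riesz_range R V V idfun (fun x => rp (f x) y) (c * nm y).
  - by rewrite mulr_ge0 ?nm_ge0 ?ltW.
  - by move=> u v; rewrite linearD rpDl.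
  - by move=> a u; rewrite linearZ rpRl.
  - move=> u /=; apply: (le_trans (cauchy_schwarz _ _)).
    by rewrite mulrAC ler_wpM2r ?nm_ge0.
  - by exists w; split.
have lg : linear g.
  move=> a x y; apply: rp_ext => u; rewrite (Hg _).2 !rpDr (Hg y).2; congr (_ + _).
  by rewrite !rpZr (Hg x).2 linearZ.
exists (Op lg (ex_intro _ c (fun y => (Hg y).1))) => x y /=.
by rewrite (Hg y).2.
Qed.

Definition adj V W (f : op V W) : op W V := projT1 (adjoint_exists f).

Lemma adjP V W (f : op V W) x y : rp (f x) y = rp x (adj f y).
Proof. exact: (projT2 (adjoint_exists f)). Qed.

Lemma adjC V W (f : op V W) x y : rp (adj f x) y = rp x (f y).
Proof. by rewrite rpC -adjP rpC. Qed.

Lemma adj_eq V W (f : op V W) (g : op W V) :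
  (forall x y, rp (f x) y = rp x (g y)) -> forall y, adj f y = g y.
Proof. by move=> H y; apply: rp_ext => u; rewrite -adjP H. Qed.

Lemma adjK V W (f : op V W) x : adj (adj f) x = f x.
Proof. by apply: adj_eq => u v; rewrite adjC. Qed.

Lemma adjM U V W (f : op V W) (g : op U V) x : adj (opM f g) x = adj g (adj f x).
Proof. by apply: (adj_eq (g := opM (adj g) (adj f))) => u v /=; rewrite !adjP. Qed.

Lemma adj_shift V (f : op V V) z x : adj (shift f z) x = shift (adj f) (Num.conj z) x.
Proof.
apply: adj_eq => u v; rewrite !shiftE !rpDl !rpDr !rpNl !rpNr adjP.
by rewrite rpZZ.
Qed.

(* Douglas: a vector dominated by [D^*] lies in the range of [D]. *)
Lemma douglas V W (D : op V W) (x : W) (c : R) : 0 <= c ->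
  (forall y, rp y x <= c * nm (adj D y)) ->
  exists w, [/\ D w = x, nm w <= c & forall e, 0 < e -> exists u, nm (w - adj D u) < e].
Proof.
move=> c0 H.
have [|||w [h1 h2 h3]] := @riesz_range R V W (adj D) (fun u => rp u x) c c0.
- by move=> u v; rewrite rpDl.
- by move=> a u; rewrite rpRl.
- exact: H.
by exists w; split => //; apply: rp_ext => u; rewrite -h3 adjC.
Qed.

Definition selfadj V (S : op V V) := forall x y, rp (S x) y = rp x (S y).

Definition commutes V (S T : op V V) := forall x, S (T x) = T (S x).

Definition projector V (P : op V V) := selfadj P /\ forall x, P (P x) = P x.

(** [P] is the orthogonal projection onto the complement of [ker D]. Here [P x] is obtained in the
    closure of the range of [adj D], which makes it orthogonal to [ker D]; together with
    [D (P x) = D x] this determines it, and linearity and self-adjointness follow from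
    uniqueness. *)
Lemma coker_projector V W (D : op V W) : exists P : op V V,
  [/\ projector P, forall x, D (P x) = D x & forall x, D x = 0 -> P x = 0].
Proof.
have /choice[P HP] : forall x, exists w, [/\ forall e, 0 < e -> exists u, nm (w - adj D u) < e,
    nm w <= nm x & D w = D x].
  move=> x.
  have [|||u|w [h1 h2 h3]] := @riesz_range R V W (adj D) (fun u => rp (adj D u) x) (nm x).
  - exact: nm_ge0.
  - by move=> u v; rewrite linearD rpDl.
  - by move=> a u; rewrite linearZ rpRl.
  - by rewrite mulrC cauchy_schwarz.
  by exists w; split => //; apply: rp_ext => u; have := h3 u; rewrite !adjC.
have orth x k : D k = 0 -> rp (P x) k = 0.
  move=> Dk; have [h _ _] := HP x.
  apply/eqP; rewrite -normr_eq0; apply/eqP.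
  apply: (@small_eq0 R _ (nm k)) => // e e0; have [u Hu] := h e e0.
  have -> : rp (P x) k = rp (P x - adj D u) k by rewrite rpDl rpNl adjC Dk rp0r subr0.
  apply: (le_trans (abs_cauchy_schwarz _ _)); rewrite mulrC ler_wpM2l ?nm_ge0// ltW//.
have DP x : D (P x) = D x by have [] := HP x.
have uniq x w : D w = D x -> (forall k, D k = 0 -> rp w k = 0) -> w = P x.
  move=> Dw Hw; apply/eqP; rewrite -subr_eq0; apply/eqP/rp_eq0.
  have Dk : D (w - P x) = 0 by rewrite linearB /= Dw DP subrr.
  by rewrite [LHS]rpDl rpNl Hw// orth// subrr.
have lP : linear P.
  move=> a x y; symmetry; apply: uniq; first by rewrite !linearP /= !DP.
  move=> k Dk; rewrite rpDl (orth y)// addr0 rpZZ orth// linearZ /= Dk scaler0//.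
have bP : exists c : R, forall x, nm (P x) <= c * nm x.
  by exists 1 => x; rewrite mul1r; have [] := HP x.
pose Pop := @Op R V V P lP bP.
exists Pop; split => //.
  split => /=; last by move=> x; symmetry; apply: uniq => // k; exact: orth.
  have half x y : rp (P x) y = rp (P x) (P y).
    have -> : rp (P x) y = rp (P x) (P y) + rp (P x) (y - P y).
      by rewrite -rpDr addrC subrK.
    by rewrite [X in _ + X]orth ?addr0// linearB /= DP subrr.
  by move=> x y; rewrite half rpC -half rpC.
by move=> x Dx /=; symmetry; apply: uniq; rewrite ?linear0 ?Dx// => k _; rewrite rp0l.
Qed.

(** A Cauchy-Schwarz inequality for a form that may be indefinite. Polarization bounds [2 <S u, v>]
    by [c (|L u|^2 + |L v|^2)], and rescaling [x] against [y] balances the two squares. The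
    parameter [e] avoids division by zero when [L x] or [L y] vanishes. *)
Lemma form_bound V W (S : op V V) (L : op V W) (c : R) : 0 <= c -> selfadj S ->
  (forall x, `|rp (S x) x| <= c * rp (L x) (L x)) ->
  forall x y, rp (S x) y <= c * (nm (L x) * nm (L y)).
Proof.
move=> c0 sS H x y.
have key u v : 2 * rp (S u) v <= c * (rp (L u) (L u) + rp (L v) (L v)).
  have h1 := le_trans (ler_norm _) (H (u + v)).
  have h2 : - rp (S (u - v)) (u - v) <= c * rp (L (u - v)) (L (u - v)).
    by apply: le_trans (H (u - v)); rewrite -normrN ler_norm.
  move: h1 h2; rewrite !linearD !linearN !rpE (rpC (L v) (L u)) (sS v u) (rpC v (S u)); lra.
set p := nm (L x); set q := nm (L y).
apply: (@small_le _ _ _ (c * (p + q))) => e e0.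
have p0 : 0 <= p := nm_ge0 _; have q0 : 0 <= q := nm_ge0 _.
have pe : 0 < p + e := ltr_wpDl p0 e0; have qe : 0 < q + e := ltr_wpDl q0 e0.
have := key (((q + e) / (p + e))%:C *: x) y.
rewrite !linearZ !rpE -!nm2 -/p -/q => K.
have {}K : 2 * rp (S x) y <= (p + e) / (q + e) *
   (c * ((q + e) / (p + e) * ((q + e) / (p + e) * (p * p)) + q * q)).
  rewrite -(ler_pM2l (x := (q + e) / (p + e))) ?divr_gt0//.
  move: K; congr (_ <= _); first by rewrite mulrCA.
  by field; rewrite !gt_eqF.
have E : (p + e) / (q + e) *
   (c * ((q + e) / (p + e) * ((q + e) / (p + e) * (p * p)) + q * q)) =
   c * ((q + e) * (p * (p / (p + e))) + (p + e) * (q * (q / (q + e)))).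
  by field; rewrite !gt_eqF.
rewrite {}E in K.
have le1 u : 0 <= u -> 0 < u + e -> u * (u / (u + e)) <= u.
  by move=> u0 ue; rewrite ler_piMr// ler_pdivrMr// mul1r lerDl ltW.
have K2 : c * ((q + e) * (p * (p / (p + e))) + (p + e) * (q * (q / (q + e)))) <=
    c * ((q + e) * p + (p + e) * q).
  by rewrite ler_wpM2l// lerD// ler_wpM2l ?le1// ltW.
have := le_trans K K2.
have : 0 <= c * (p + q) * e by rewrite !mulr_ge0 ?addr_ge0// ltW.
lra.
Qed.

End Operators.

(** * Spectral projections of self-adjoint operators *)

Section SquareRoot.
Variables (R : realType) (V : hilbert R).
Implicit Types (S Z : op V V).

Lemma nm_real (a : R) (x : V) : 0 <= a -> nm (a%:C *: x) = a * nm x.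
Proof. by move=> a0; rewrite nmZ cabs_real ger0_norm. Qed.

Lemma nm_small_eq0 (x : V) (k : R) : (forall e, 0 < e -> nm x <= k * e) -> x = 0.
Proof. by move=> H; apply: nm_eq0; apply: (@small_eq0 R _ k) => //; exact: nm_ge0. Qed.

Section Iteration.
Variable A : op V V.
Hypotheses (sA : selfadj A) (A1 : forall x, nm (A x) <= nm x).

(* The iteration converges to [1 - sqrt (1 - A)]; its increments are polynomials in [A] with
   nonnegative coefficients, so the same iteration started from the norm [1] of [A] bounds
   them. *)
Fixpoint sqrt_iter n : op V V :=
  if n is m.+1 then opZ (1/2)%:C (opD A (opM (sqrt_iter m) (sqrt_iter m))) else opZ 0 (op1 V).

Fixpoint iter_bd n : R :=
  if n is m.+1 then (1 + iter_bd m * iter_bd m) / 2 else 0.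

Let t01 n : 0 <= iter_bd n <= 1.
Proof.
elim: n => [|n /andP[t0 t1]] /=; first by rewrite lexx ler01.
have h0 : 0 <= iter_bd n * iter_bd n by rewrite mulr_ge0.
have h1 : iter_bd n * iter_bd n <= 1 by rewrite mulr_ile1.
by apply/andP; split; lra.
Qed.

Let tS n : iter_bd n <= iter_bd n.+1.
Proof.
have := sqr_ge0 (iter_bd n - 1); rewrite sqrrB /=; lra.
Qed.

Let tmono : {homo iter_bd : m n / (m <= n)%N >-> m <= n}.
Proof. by apply: homo_leq => //; exact: le_trans. Qed.

Let yE n x : sqrt_iter n.+1 x = (1/2)%:C *: (A x + sqrt_iter n (sqrt_iter n x)).
Proof. by []. Qed.

Let ycomm Z : commutes Z A -> forall n, commutes Z (sqrt_iter n).
Proof.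
move=> ZA; elim=> [|n IH] x; first by rewrite /= !scale0r opf0.
by rewrite !yE opfZ opfD ZA !IH.
Qed.

Let yy m n : commutes (sqrt_iter m) (sqrt_iter n).
Proof. by apply: ycomm => x; rewrite ycomm. Qed.

Let ynm n x : nm (sqrt_iter n x) <= iter_bd n * nm x.
Proof.
elim: n x => [|n IH] x; first by rewrite /= scale0r nm0 mul0r.
rewrite yE nm_real; last by lra.
have /andP[t0 _] := t01 n.
have h1 : nm (sqrt_iter n (sqrt_iter n x)) <= iter_bd n * (iter_bd n * nm x).
  by apply: (le_trans (IH _)); rewrite ler_wpM2l.
have h2 := nmD (A x) (sqrt_iter n (sqrt_iter n x)); have h3 := A1 x.
rewrite /=; lra.
Qed.

Let ystep n x : nm (sqrt_iter n.+1 x - sqrt_iter n x) <= (iter_bd n.+1 - iter_bd n) * nm x.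
Proof.
elim: n x => [|n IH] x.
  by rewrite /= !scale0r subr0 subr0 addr0 mul0r addr0 nm_real ?ler_wpM2l//; lra.
rewrite !(yE _ x) -scalerBr opprD addrACA subrr add0r nm_real; last by lra.
set d := sqrt_iter n.+1 x - sqrt_iter n x.
(* A difference of squares, factored because the iterates commute. *)
have -> : sqrt_iter n.+1 (sqrt_iter n.+1 x) - sqrt_iter n (sqrt_iter n x) =
    sqrt_iter n.+1 d + sqrt_iter n d.
  by rewrite /d !opfB (yy n.+1 n) addrA subrK.
have h := nmD (sqrt_iter n.+1 d) (sqrt_iter n d).
have h1 := ynm n.+1 d; have h2 := ynm n d.
have /andP[t0 _] := t01 n; have /andP[t0' _] := t01 n.+1.
have h3 := ler_wpM2l (addr_ge0 t0' t0) (IH x).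
have -> : iter_bd n.+2 = (1 + iter_bd n.+1 * iter_bd n.+1) / 2 by [].
have E : iter_bd n.+1 = (1 + iter_bd n * iter_bd n) / 2 by [].
rewrite -/d in h3; move: (iter_bd n.+1) E h1 h3 => t' E h1 h3.
have -> : ((1 + t' * t') / 2 - t') * nm x = 1 / 2 * ((t' + iter_bd n) * ((t' - iter_bd n) * nm x)).
  by rewrite [in X in _ - X]E; ring.
by rewrite ler_wpM2l//; lra.
Qed.

Let ydist m n x : (m <= n)%N ->
  nm (sqrt_iter n x - sqrt_iter m x) <= (iter_bd n - iter_bd m) * nm x.
Proof.
elim: n => [|n IH]; first by rewrite leqn0 => /eqP->; rewrite !subrr nm0 mul0r.
rewrite leq_eqVlt => /orP[/eqP->|]; first by rewrite !subrr nm0 mul0r.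
rewrite ltnS => /IH h; have h' := ystep n x.
have -> : sqrt_iter n.+1 x - sqrt_iter m x =
    (sqrt_iter n.+1 x - sqrt_iter n x) + (sqrt_iter n x - sqrt_iter m x).
  by rewrite addrA subrK.
apply: (le_trans (nmD _ _)); lra.
Qed.

Let tcauchy (e : R) : 0 < e -> exists N, forall m n, (N <= m)%N -> (m <= n)%N ->
  iter_bd n - iter_bd m < e.
Proof.
move=> e0; pose T : set R := fun r => exists n, iter_bd n = r.
have supT : has_sup T.
  split; first by exists (iter_bd 0), 0%N.
  by exists 1 => _ [n <-]; have /andP[] := t01 n.
have [_ [N <-] HN] := sup_adherent e0 supT.
exists N => m n Nm mn.
have : iter_bd n <= sup T by apply: (ub_le_sup supT.2); exists n.
have := tmono Nm; lra.
Qed.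

(** The equation [2 Y = A + Y^2] says [(1 - Y)^2 = 1 - A]. Convergence is uniform on bounded sets
    ([unif]), which lets every property pass from the iterates to [Y]. *)
Lemma sqrt_iteration : exists Y : op V V, [/\ selfadj Y, forall x, nm (Y x) <= nm x,
  forall x, Y x + Y x = A x + Y (Y x) & forall Z, commutes Z A -> commutes Z Y].
Proof.
have /choice[Y HY] : forall x, exists l, tends (fun n => sqrt_iter n x) l.
  move=> x; apply: hilbert_complete => e e0.
  have nx : 0 < nm x + 1 by rewrite ltr_wpDl ?nm_ge0.
  have [N HN] := tcauchy (divr_gt0 e0 nx).
  have key m n : (N <= m)%N -> (m <= n)%N -> nm (sqrt_iter n x - sqrt_iter m x) < e.
    move=> Nm mn; apply: (le_lt_trans (ydist x mn)).
    have := HN m n Nm mn; rewrite ltr_pdivlMr// => h.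
    have := tmono mn; rewrite -subr_ge0 => h'; move: h; rewrite mulrDr mulr1; lra.
  exists N => m n Nm Nn; have [mn|nm_] := leqP m n.
    by rewrite nm_distC key.
  by rewrite key// ltnW.
have unif (e : R) : 0 < e -> exists N, forall n, (N <= n)%N -> forall x,
    nm (Y x - sqrt_iter n x) <= e * nm x.
  move=> e0; have [N HN] := tcauchy e0; exists N => n Nn x.
  apply: (@small_le _ _ _ 1) => d d0; have [M HM] := HY x d d0.
  have := HM (maxn M n) (leq_maxl _ _); have mn := leq_maxr M n.
  have := ydist x mn; move: (maxn M n) mn => k nk h1 h2.
  have h3 : (iter_bd k - iter_bd n) * nm x <= e * nm x.
    by rewrite ler_wpM2r ?nm_ge0// ltW// HN.
  have -> : Y x - sqrt_iter n x = (sqrt_iter k x - sqrt_iter n x) - (sqrt_iter k x - Y x) by vring.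
  apply: (le_trans (nmB _ _)); lra.
have Y1 x : nm (Y x) <= nm x.
  apply: (@small_le _ _ _ (nm x)) => e e0; have [N HN] := unif e e0.
  have -> : Y x = (Y x - sqrt_iter N x) + sqrt_iter N x by rewrite subrK.
  have := nmD (Y x - sqrt_iter N x) (sqrt_iter N x); have := HN N (leqnn _) x; have := ynm N x.
  have /andP[_ t1] := t01 N; have := ler_wpM2r (nm_ge0 x) t1.
  by rewrite mul1r subrK; lra.
have lY : linear Y.
  move=> a x y; apply/eqP; rewrite -subr_eq0; apply/eqP.
  apply: (@nm_small_eq0 _ (nm (a *: x + y) + (cabs a * nm x + nm y))) => e e0.
  have [N HN] := unif e e0.
  have -> : Y (a *: x + y) - (a *: Y x + Y y) = (Y (a *: x + y) - sqrt_iter N (a *: x + y)) -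
     (a *: (Y x - sqrt_iter N x) + (Y y - sqrt_iter N y)).
    by rewrite opfD opfZ scalerBr; vring.
  apply: (le_trans (nmB _ _)).
  have := HN N (leqnn _) (a *: x + y).
  have := nmD (a *: (Y x - sqrt_iter N x)) (Y y - sqrt_iter N y); rewrite nmZ.
  have := HN N (leqnn _) y.
  have := ler_wpM2l (cabs_ge0 a) (HN N (leqnn _) x); lra.
have bY : exists c : R, forall x, nm (Y x) <= c * nm x.
  by exists 1 => x; rewrite mul1r.
exists (Op lY bY); split => //=.
- move=> x y /=; apply/eqP; rewrite -subr_eq0 -normr_eq0; apply/eqP.
  apply: (@small_eq0 R _ (2 * (nm x * nm y))) => // e e0; have [N HN] := unif e e0.
  have sy : rp (sqrt_iter N x) y = rp x (sqrt_iter N y).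
    elim: N {HN} x y => [|n IH] x y; first by rewrite /= !scale0r rp0l rp0r.
    by rewrite !yE !rpE sA !IH.
  have -> : rp (Y x) y - rp x (Y y) = rp (Y x - sqrt_iter N x) y - rp x (Y y - sqrt_iter N y).
    by rewrite !rpE sy; ring.
  apply: (le_trans (ler_normB _ _)).
  have h1 := abs_cauchy_schwarz (Y x - sqrt_iter N x) y.
  have h2 := abs_cauchy_schwarz x (Y y - sqrt_iter N y).
  have := ler_wpM2r (nm_ge0 y) (HN N (leqnn _) x).
  have := ler_wpM2l (nm_ge0 x) (HN N (leqnn _) y); lra.
- move=> x; apply/eqP; rewrite -subr_eq0; apply/eqP.
  apply: (@nm_small_eq0 _ (3 * nm x + nm (Y x))) => e e0; have [N HN] := unif e e0.
  have h1 := HN N.+1 (leqnSn _) x.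
  have h2 := HN N (leqnn _) x.
  have h3 := HN N (leqnn _) (Y x).
  have yA : A x = sqrt_iter N.+1 x + sqrt_iter N.+1 x - sqrt_iter N (sqrt_iter N x).
    rewrite yE -scalerDl -rmorphD /= (_ : 1 / 2 + 1 / 2 = 1); last by lra.
    by rewrite scale1r addrK.
  have -> : Y x + Y x - (A x + Y (Y x)) = (Y x - sqrt_iter N.+1 x) + (Y x - sqrt_iter N.+1 x) -
     ((Y (Y x) - sqrt_iter N (Y x)) + sqrt_iter N (Y x - sqrt_iter N x)).
    by rewrite yA opfB; vring.
  apply: (le_trans (nmB _ _)).
  have h4 := nmD (Y x - sqrt_iter N.+1 x) (Y x - sqrt_iter N.+1 x).
  have h5 := nmD (Y (Y x) - sqrt_iter N (Y x)) (sqrt_iter N (Y x - sqrt_iter N x)).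
  have h6 := ynm N (Y x - sqrt_iter N x).
  have /andP[_ t1] := t01 N; have := ler_wpM2r (nm_ge0 (Y x - sqrt_iter N x)) t1.
  rewrite mul1r; lra.
- move=> Z ZA x /=; apply/eqP; rewrite -subr_eq0; apply/eqP.
  have [c c0 Hc] := op_bound Z.
  apply: (@nm_small_eq0 _ (c * nm x + nm (Z x))) => e e0; have [N HN] := unif e e0.
  have -> : Z (Y x) - Y (Z x) = Z (Y x - sqrt_iter N x) - (Y (Z x) - sqrt_iter N (Z x)).
    by rewrite opfB (ycomm ZA) opprB addrA subrK.
  apply: (le_trans (nmB _ _)).
  have := ler_wpM2l (ltW c0) (HN N (leqnn _) x).
  have := HN N (leqnn _) (Z x); have := Hc (Y x - sqrt_iter N x); lra.
Qed.

End Iteration.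

(** With [A = 1 - S^2], the operator [1 - Y] is a square root of [S^2], and it is positive because
    [Y] is a contraction. *)
Lemma abs_contraction S : selfadj S -> (forall x, nm (S x) <= nm x) ->
  exists T : op V V, [/\ selfadj T, forall x, T (T x) = S (S x), forall x, 0 <= rp (T x) x &
    forall Z, commutes Z S -> commutes Z T].
Proof.
move=> sS S1.
pose A := opB (op1 V) (opM S S).
have AE x : A x = x - S (S x) by rewrite /A opBE.
have sA : selfadj A by move=> x y; rewrite !AE !rpE !sS.
have A1 x : nm (A x) <= nm x.
  apply: nm_le; first exact: nm_ge0.
  rewrite AE !rpE nm2 (rpC (S (S x)) x) -!sS.
  have := ler_pM (nm_ge0 _) (nm_ge0 _) (S1 (S x)) (S1 (S x)); rewrite !nm2 -!sS.
  have := rp_ge0 (S x); rewrite -sS; lra.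
have [Y [sY Y1 YE Yc]] := sqrt_iteration sA A1.
have TE x : opB (op1 V) Y x = x - Y x by rewrite opBE.
exists (opB (op1 V) Y); split.
- by move=> x y; rewrite !TE !rpE sY.
- move=> x; rewrite !TE opfB.
  have -> : S (S x) = x - A x by rewrite AE opprB addrC subrK.
  have -> : A x = Y x + Y x - Y (Y x) by rewrite YE addrK.
  by rewrite !opprD !opprK !addrA.
- move=> x; rewrite TE !rpE subr_ge0; apply: (le_trans (cauchy_schwarz _ _)).
  by rewrite -nm2 ler_wpM2r ?nm_ge0.
- move=> Z ZS x; rewrite !TE opfB Yc// => u.
  by rewrite !AE opfB !ZS.
Qed.

Lemma abs_op S : selfadj S ->
  exists T : op V V, [/\ selfadj T, forall x, T (T x) = S (S x), forall x, 0 <= rp (T x) x &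
    forall Z, commutes Z S -> commutes Z T].
Proof.
move=> sS; have [c c0 Hc] := op_bound S.
pose S' := opZ (c^-1)%:C S.
have [||T [sT TT T0 Tc]] := @abs_contraction S'.
- by move=> x y /=; rewrite !rpE sS.
- move=> x /=; rewrite nm_real ?invr_ge0 ?(ltW c0)//.
  by rewrite ler_pdivrMl.
exists (opZ c%:C T); split.
- by move=> x y /=; rewrite !rpE sT.
- move=> x /=; rewrite opfZ TT /= opfZ !scalerA -!rmorphM /=.
  by rewrite [X in X%:C](_ : _ = 1) ?scale1r//; field; rewrite gt_eqF.
- by move=> x /=; rewrite rpRl mulr_ge0// ltW.
- by move=> Z ZS x /=; rewrite opfZ Tc// => u /=; rewrite opfZ ZS.
Qed.

Lemma adj_commutes S Z : selfadj S -> commutes Z S -> commutes (adj Z) S.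
Proof.
move=> sS ZS x; apply: rp_ext => u.
by rewrite -adjP -sS -ZS adjP sS.
Qed.

(** With [D = S - c] and [T] its absolute value, [E] projects onto the kernel of [T + D], twice the
    positive part of [D]. There [D = - T] is negative, and on the orthogonal complement [D = T]
    because [(T + D) (T - D) = 0]. So [E] is the spectral projection of [S] for the half-line up to
    [c]. *)
Lemma spectral_projector S (c : R) : selfadj S -> exists E : op V V,
  [/\ projector E, forall x, rp (S (E x)) (E x) <= c * rp (E x) (E x),
      forall x, E x = 0 -> c * rp x x <= rp (S x) x &
      forall Z, commutes Z S -> commutes Z E].
Proof.
move=> sS; pose D := shift S c%:C.
have DE x : D x = S x - c%:C *: x by rewrite /D shiftE.
have sD : selfadj D by move=> x y; rewrite !DE !rpE sS.
have [T [sT TT T0 Tc]] := abs_op sD.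
have TD : commutes D T by apply: Tc.
have ZD Z : commutes Z S -> commutes Z D by move=> ZS x; rewrite !DE opfB opfZ ZS.
pose Q := opD T D.
have QE x : Q x = T x + D x by [].
have [P [[sP PP] QP QP0]] := coker_projector Q.
have EE x : opB (op1 V) P x = x - P x by rewrite opBE.
exists (opB (op1 V) P); split.
- split; first by move=> x y; rewrite !EE !rpE sP.
  by move=> x; rewrite !EE opfB PP subrr subr0.
- move=> x; set e := opB _ _ _.
  have : Q e = 0 by rewrite /e EE opfB QP subrr.
  rewrite QE => /eqP; rewrite addr_eq0 => /eqP Te.
  have := T0 e; rewrite Te rpNl DE !rpE; lra.
- move=> x; rewrite EE => /eqP; rewrite subr_eq0 => /eqP Px.
  have De : D x = T x.
    apply: rp_ext => u; rewrite Px -sD -sT; apply/eqP; rewrite -subr_eq0 -rpNl -rpDl.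
    rewrite -sP QP0 ?rp0l// QE !opfB TT TD; vring.
  have := T0 x; rewrite -De DE !rpE; lra.
(* The kernel of [Q] is invariant under [Z]. The same for [adj Z], which also commutes with [S],
   makes [P] commute with [Z]. *)
- have key Z : commutes Z S -> forall x, P (Z x) = P (Z (P x)).
    move=> ZS x; apply/eqP; rewrite -subr_eq0 -opfB -opfB; apply/eqP/QP0.
    have ZQ u : Q (Z u) = Z (Q u) by rewrite !QE opfD (Tc _ (ZD _ ZS)) (ZD _ ZS).
    by rewrite ZQ opfB QP subrr opf0.
  move=> Z ZS x; rewrite !EE opfB; congr (_ - _).
  rewrite key//; apply: rp_ext => u.
  by rewrite -adjC -sP key ?sP ?adjC ?sP//; exact: adj_commutes.
Qed.

End SquareRoot.

(** * The ranges of the translates of a normal operator *)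

Section NormalRanges.
Variables (R : realType) (V : hilbert R).
Implicit Types (S Z E N : op V V).

Lemma projector_nm E x : projector E -> nm (E x) <= nm x.
Proof.
move=> [sE EE]; have [->|/eqP w0] := eqVneq (E x) 0; first by rewrite nm0 nm_ge0.
rewrite -(ler_pM2r (nm_gt0 w0)) nm2.
by rewrite -sE EE rpC cauchy_schwarz.
Qed.

Lemma projector_split E S (m : R) : projector E -> selfadj S -> commutes E S ->
  exists E1 E2 : op V V, [/\ projector E1 /\ projector E2,
    (forall x, E (E1 x) = E1 x) /\ (forall x, E (E2 x) = E2 x),
    (forall x, rp (S (E1 x)) (E1 x) <= m * rp (E1 x) (E1 x)) /\
    (forall x, m * rp (E2 x) (E2 x) <= rp (S (E2 x)) (E2 x)),
    forall x, rp (E x) (E x) = rp (E1 x) (E1 x) + rp (E2 x) (E2 x) &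
    forall Z, commutes Z E -> commutes Z S -> commutes Z E1 /\ commutes Z E2].
Proof.
move=> [sE EE] sS ES; have [F [[sF FF] F1 F2 Fc]] := spectral_projector m sS.
have EF := Fc _ ES.
pose E2 := opB E (opM E F).
have E2E x : E2 x = E (x - F x) by rewrite /E2 opBE opfB.
exists (opM E F), E2; split.
- split; split.
  + by move=> x y /=; rewrite sE sF -EF.
  + by move=> x /=; rewrite -[in LHS]EF FF EE.
  + by move=> x y; rewrite !E2E sE !opfB !rpE sF EF.
  + by move=> x; rewrite !E2E !opfB !EE -!EF !EE !FF subrr subr0.
- by split=> x; rewrite ?E2E /= EE.
- split=> x; first by rewrite /= EF; exact: F1.
  by apply: F2; rewrite E2E -EF opfB FF subrr opf0.
- move=> x; rewrite E2E /= opfB !rpE (rpC (E (F x)) (E x)).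
  have -> : rp (E (F x)) (E (F x)) = rp (E x) (E (F x)); last by ring.
  by rewrite -[in RHS]FF [E (F (F x))]EF -sF -EF.
- move=> Z ZE ZS; split=> x; first by rewrite /= ZE Fc.
  by rewrite !E2E ZE opfB Fc.
Qed.

(** Passes from the quadratic form to the norm: the compression [D] of [S - s] to the range of [E]
    has form at most [h |E u|^2], and [form_bound] is used at [y = D x]. *)
Lemma form_norm E S (s a h : R) : projector E -> selfadj S -> commutes E S -> 0 <= h ->
  a <= s <= a + h ->
  (forall x, a * rp (E x) (E x) <= rp (S (E x)) (E x) <= (a + h) * rp (E x) (E x)) ->
  forall x, nm (S (E x) - s%:C *: E x) <= h * nm (E x).
Proof.
move=> [sE EE] sS ES h0 /andP[as_ sa] H x.
pose D := opM E (opM (shift S s%:C) E).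
have DE u : D u = S (E u) - s%:C *: E u.
  by rewrite -[LHS]/(E (shift S s%:C (E u))) shiftE opfB opfZ EE -ES EE.
have sD : selfadj D.
  by move=> u v; rewrite !DE !rpE sS !sE ES.
have bD u : `|rp (D u) u| <= h * rp (E u) (E u).
  have -> : rp (D u) u = rp (S (E u)) (E u) - s * rp (E u) (E u).
    by rewrite DE !rpE -[in LHS](EE u) -ES !sE.
  have /andP[h1 h2] := H u; have p := rp_ge0 (E u).
  have k1 : 0 <= (s - a) * rp (E u) (E u) by rewrite mulr_ge0// subr_ge0.
  have k2 : 0 <= (a + h - s) * rp (E u) (E u) by rewrite mulr_ge0// subr_ge0.
  by rewrite ler_norml; apply/andP; split; lra.
have := @form_bound R V V D E h h0 sD bD x (D x).
rewrite -!DE -nm2.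
have -> : E (D x) = D x by rewrite DE opfB opfZ ES EE.
have [->|/eqP w0] := eqVneq (D x) 0; first by rewrite nm0 mulr_ge0 ?nm_ge0.
by rewrite mulrA ler_pM2r ?nm_gt0.
Qed.

(** Let [z] be the limit of the squares, [hn] the side at level [n], [E] the projection, and
    [x = (N - z)' f] with [f] in the closure of the range of [N - z]. Both [N - z] and its adjoint
    have norm at most [2 hn] on the range of [E]. Hence [|E x| <= 2 hn |E f|], and [|E f|] tends to
    0 since [f] is approximated by vectors [(N - z) u]. This contradicts [|E x| >= |x| / 2^n] unless
    [x = 0]. *)
Lemma cartesian_range_trivial N S S' x : selfadj S -> selfadj S' -> commutes S S' ->
  (forall u, N u = S u + Complex 0 1 *: S' u) ->
  (forall u, adj N u = S u - Complex 0 1 *: S' u) ->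
  (forall z, exists f, adj (shift N z) f = x) -> x = 0.
Proof.
move=> sS sS' SS' NE NsE ran.
have [c1 c10 H1] := op_bound S; have [c2 c20 H2] := op_bound S'.
pose c := c1 + c2; pose h := 2 * c.
have h0 : 0 <= h by rewrite /h /c; lra.
pose bad n (a b : R) := exists E, [/\ projector E, commutes E S /\ commutes E S',
  forall x, a * rp (E x) (E x) <= rp (S (E x)) (E x) <= (a + h / 2 ^+ n) * rp (E x) (E x),
  forall x, b * rp (E x) (E x) <= rp (S' (E x)) (E x) <= (b + h / 2 ^+ n) * rp (E x) (E x) &
  rp x x / 4 ^+ n <= rp (E x) (E x)].
have half n : h / 2 ^+ n = h / 2 ^+ n.+1 + h / 2 ^+ n.+1.
  rewrite exprS; have : (2 ^+ n : R) != 0 by rewrite expf_neq0// pnatr_eq0.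
  by move=> ?; field.
have quarter n : rp x x / 4 ^+ n = 4 * (rp x x / 4 ^+ n.+1).
  rewrite exprS; have : (4 ^+ n : R) != 0 by rewrite expf_neq0// pnatr_eq0.
  by move=> ?; field.
have init (Q : op V V) k u : 0 < k -> k <= c -> (forall u, nm (Q u) <= k * nm u) ->
    - c * rp u u <= rp (Q u) u <= (- c + h / 2 ^+ 0) * rp u u.
  move=> k0 kc HQ; have := abs_cauchy_schwarz (Q u) u; rewrite ler_norml => /andP[h1 h2].
  have := ler_wpM2r (nm_ge0 u) (HQ u); rewrite -mulrA nm2.
  have : k * rp u u <= c * rp u u by rewrite ler_wpM2r ?rp_ge0.
  by rewrite expr0 divr1 /h; move=> *; apply/andP; split; lra.
have [|n a b [E [pE [ES ES'] Sb S'b Ex]]|s [t st]] := @bisection R bad (- c) (- c) h h h0 h0.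
- exists (op1 V); split => //=.
  + by move=> u; apply: (init S c1) => //; rewrite /c; lra.
  + by move=> u; apply: (init S' c2) => //; rewrite /c; lra.
  + by rewrite expr0 divr1.
- have [E1 [E2 [[pE1 pE2] [EE1 EE2] [up lo] sum12 comm]]] :=
    projector_split (a + h / 2 ^+ n.+1) pE sS ES.
  have SE : commutes S E by move=> u; rewrite ES.
  have S'E : commutes S' E by move=> u; rewrite ES'.
  have [SE1 SE2] := comm S SE (fun u => erefl).
  have [S'E1 S'E2] := comm S' S'E (fun u => esym (SS' u)).
  have sub a' (G : op V V) : projector G -> commutes S G -> commutes S' G ->
      (forall u, E (G u) = G u) ->
      (forall u, a' * rp (G u) (G u) <= rp (S (G u)) (G u) <=
                 (a' + h / 2 ^+ n.+1) * rp (G u) (G u)) ->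
      2 * (rp x x / 4 ^+ n.+1) <= rp (G x) (G x) ->
      exists b', bad n.+1 a' b' /\ (b' = b \/ b' = b + h / 2 ^+ n.+1).
    move=> pG SG S'G EG Gb Gx.
    have GS' : commutes G S' by move=> u; rewrite S'G.
    have [G1 [G2 [[pG1 pG2] [GG1 GG2] [gup glo] gsum gcomm]]] :=
      projector_split (b + h / 2 ^+ n.+1) pG sS' GS'.
    have [SG1 SG2] := gcomm S SG SS'.
    have [S'G1 S'G2] := gcomm S' S'G (fun u => erefl).
    have EG1 u : E (G1 u) = G1 u by rewrite -GG1 EG.
    have EG2 u : E (G2 u) = G2 u by rewrite -GG2 EG.
    have [big|small] := leP (rp x x / 4 ^+ n.+1) (rp (G1 x) (G1 x)).
      exists b; split; last by left.
      exists G1; split => //; first by split=> u; rewrite ?SG1 ?S'G1.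
        by move=> u; rewrite -(GG1 u); exact: Gb.
      by move=> u; have := S'b (G1 u); rewrite EG1 gup andbT => /andP[].
    exists (b + h / 2 ^+ n.+1); split; last by right.
    exists G2; split => //; first by split=> u; rewrite ?SG2 ?S'G2.
    + by move=> u; rewrite -(GG2 u); exact: Gb.
    + by move=> u; have := S'b (G2 u); rewrite EG2 glo (half n) addrA => /andP[].
    + by move: Gx; rewrite gsum; lra.
  (* Halving along [S] leaves one half with at least half of the mass, which is [2 / 4 ^+ n.+1] of
     [rp x x]; [sub] then halves along [S']. *)
  have [big|small] := leP (2 * (rp x x / 4 ^+ n.+1)) (rp (E1 x) (E1 x)).
    have [|b' [bb hb']] := sub a E1 pE1 SE1 S'E1 EE1 _ big.
      by move=> u; have := Sb (E1 u); rewrite EE1 up andbT => /andP[].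
    by exists a, b'; split => //; left.
  have [||b' [bb hb']] := sub (a + h / 2 ^+ n.+1) E2 pE2 SE2 S'E2 EE2.
  + by move=> u; have := Sb (E2 u); rewrite EE2 lo (half n) addrA => /andP[].
  + by move: Ex; rewrite sum12 quarter; lra.
  + by exists (a + h / 2 ^+ n.+1), b'; split => //; right.
- have [f0 Hf0] := ran (Complex s t).
  pose M := shift N (Complex s t).
  (* A preimage [f0] is already given; Douglas' lemma replaces it by one in the closure of the range
     of [M]. *)
  have [y|f [Mf _ dense]] := @douglas R V V (adj M) x (nm f0) (nm_ge0 f0).
    rewrite -Hf0 -adjP; apply: (le_trans (cauchy_schwarz _ _)).
    by rewrite mulrC [nm (adj _ _)](_ : _ = nm (M y))// adjK.
  have zE u : Complex s t *: u = s%:C *: u + Complex 0 1 *: (t%:C *: u).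
    by rewrite scalerA -scalerDl; congr (_ *: _); apply/eqP; rewrite eq_complex /=;
       apply/andP; split; apply/eqP; ring.
  have zcE u : Num.conj (Complex s t) *: u = s%:C *: u - Complex 0 1 *: (t%:C *: u).
    by rewrite conjE /= scalerA -scalerBl; congr (_ *: _); apply/eqP; rewrite eq_complex /=;
       apply/andP; split; apply/eqP; ring.
  have ME u : M u = (S u - s%:C *: u) + Complex 0 1 *: (S' u - t%:C *: u).
    by rewrite /M shiftE NE zE scalerBr; vring.
  have MsE u : adj M u = (S u - s%:C *: u) - Complex 0 1 *: (S' u - t%:C *: u).
    by rewrite /M adj_shift shiftE NsE zcE scalerBr; vring.
  have ci : cabs (Complex 0 1 : R[i]) = 1 by rewrite /cabs /= expr0n expr1n add0r sqrtr1.
  apply: nm_eq0; apply: (@small_eq0 R _ (4 * h)) => [|e e0]; first exact: nm_ge0.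
  have [u Hu] := dense e e0; rewrite adjK in Hu.
  (* The order of choices matters: [u] depends on [e] only, and then [n] is taken so large that
     [2 * (hn * nm u) <= e]. *)
  have k0 : 0 < nm u * 2 + 1 by rewrite ltr_wpDl// mulr_ge0 ?nm_ge0.
  have [n Hn] := halves_small h (divr_gt0 e0 k0).
  have [a [b [[E [pE [ES ES'] Sb S'b Ex]] as_ bt]]] := st n.
  set hn := h / 2 ^+ n in as_ bt Sb S'b *.
  have hn0 : 0 <= hn by rewrite divr_ge0 ?exprn_ge0.
  have F1 := form_norm pE sS ES hn0 as_ Sb.
  have F2 := form_norm pE sS' ES' hn0 bt S'b.
  have ED v : E (M v) = M (E v) by rewrite !ME opfD opfZ !opfB !opfZ ES ES'.
  have EDs v : E (adj M v) = adj M (E v).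
    by rewrite !MsE opfB opfZ !opfB !opfZ ES ES'.
  have B1 v : nm (M (E v)) <= 2 * (hn * nm (E v)).
    rewrite ME; apply: (le_trans (nmD _ _)); rewrite nmZ ci mul1r.
    by have := F1 v; have := F2 v; lra.
  have B2 v : nm (adj M (E v)) <= 2 * (hn * nm (E v)).
    rewrite MsE; apply: (le_trans (nmB _ _)); rewrite nmZ ci mul1r.
    by have := F1 v; have := F2 v; lra.
  have x2 : nm x / 2 ^+ n <= nm (E x).
    rewrite -(ler_pXn2r (n := 2)) ?nnegrE ?nm_ge0 ?divr_ge0 ?exprn_ge0 ?nm_ge0//.
    by rewrite expr_div_n -exprM mulnC exprM !expr2 !nm2 -natrM.
  have Ef : nm (E f) <= e + 2 * (hn * nm u).
    have -> : E f = E (f - M u) + M (E u) by rewrite opfB ED subrK.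
    apply: (le_trans (nmD _ _)); apply: lerD.
      by apply: (le_trans (projector_nm _ pE)); exact: ltW.
    by apply: (le_trans (B1 u)); rewrite ler_pM2l// ler_wpM2l// projector_nm.
  have := B2 f; rewrite -EDs Mf => /(le_trans x2).
  have z0 : 0 < 2 ^+ n :> R by rewrite exprn_gt0.
  rewrite ler_pdivrMr// => Hx.
  have hn2 : hn * 2 ^+ n = h by rewrite /hn mulfVK// gt_eqF.
  have {}Hx : nm x <= 2 * (h * nm (E f)).
    by move: Hx; congr (_ <= _); rewrite -hn2; ring.
  have hnu : 2 * (hn * nm u) <= e.
    have : `|h| / 2 ^+ n = hn by rewrite ger0_norm.
    move=> hE; rewrite hE ltr_pdivlMr// in Hn; lra.
  have : h * nm (E f) <= h * (e + e) by rewrite ler_wpM2l//; lra.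
  lra.
Qed.

Definition normal N := commutes N (adj N).

Lemma normal_range_trivial N x : normal N ->
  (forall z, exists f, adj (shift N z) f = x) -> x = 0.
Proof.
move=> nN.
pose S := opZ (1/2)%:C (opD N (adj N)).
pose S' := opZ (Complex 0 (- (1/2))) (opB N (adj N)).
have SE u : S u = (1/2)%:C *: (N u + adj N u) by [].
have S'E u : S' u = Complex 0 (- (1/2)) *: (N u - adj N u) by rewrite /S' /= scaleN1r.
have iS' u : Complex 0 1 *: S' u = (1/2)%:C *: (N u - adj N u).
  rewrite S'E scalerA; congr (_ *: _); apply/eqP; rewrite eq_complex /=.
  by apply/andP; split; apply/eqP; ring.
apply: (@cartesian_range_trivial N S S').
- by move=> u v; rewrite !SE !rpE adjP adjC; ring.
- move=> u v; rewrite !S'E rpZZ.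
  have -> : Num.conj (Complex 0 (- (1 / 2))) = - Complex 0 (- (1/2)) :> R[i].
    by rewrite conjE; apply/eqP; rewrite eq_complex /= oppr0 !eqxx.
  have D0 a b : rp (N a - adj N a) b = - rp a (N b - adj N b).
    by rewrite !rpE adjP adjC; ring.
  by rewrite scaleNr rpNr D0 opprK opfZ opfZ -scalerBr.
- move=> u; rewrite [LHS]SE [RHS]S'E [in LHS]S'E [in RHS]SE !opfZ !opfB !opfD !nN.
  by rewrite -scalerDr -scalerBr !scalerA mulrC; congr (_ *: _); vring.
- by move=> u; rewrite iS' SE; apply: rp_ext => v; rewrite !rpE; field.
- by move=> u; rewrite iS' SE; apply: rp_ext => v; rewrite !rpE; field.
Qed.

End NormalRanges.

(** * Intertwining with a dominant operator *)

Section Dominant.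
Variables (R : realType).
Implicit Types (V W G K : hilbert R).

Definition hypo_at V (A : op V V) (z : R[i]) (m : R) :=
  forall x, nm (adj (shift A z) x) <= m * nm (shift A z x).

Definition dominant_op V (B : op V V) := forall z, exists2 m, 0 <= m & hypo_at B z m.

Lemma dominant_range K (B : op K K) : dominant_op B ->
  forall z u, exists w, adj (shift B z) w = shift B z u.
Proof.
move=> domB z u; have [m m0 Hm] := domB z.
have [|y|w [Mw _ _]] := @douglas R K K (adj (shift B z)) (shift B z u) (m * nm u).
- by rewrite mulr_ge0 ?nm_ge0.
- rewrite adjK rpC adjP rpC; apply: (le_trans (cauchy_schwarz _ _)).
  by rewrite mulrAC ler_wpM2r ?nm_ge0.
by exists w.
Qed.

(** The complex inner product recovered from its real part, for use as a complex-valued function in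
    Liouville's theorem. *)
Definition cip V (x y : V) : R[i] := Complex (rp x y) (rp x (Complex 0 1 *: y)).

Lemma rp_i V (x y : V) : rp (Complex 0 1 *: x) y = - rp x (Complex 0 1 *: y).
Proof.
rewrite rpZZ (_ : Num.conj (Complex 0 1) = - Complex 0 1) ?scaleNr ?rpNr//.
by rewrite conjE; apply/eqP; rewrite eq_complex /= oppr0 !eqxx.
Qed.

Lemma cipZ V z (x y : V) : cip (z *: x) y = z * cip x y.
Proof.
apply/eqP; rewrite eq_complex /= !(rpZl z) !rp_i scalerA.
rewrite (_ : Complex 0 1 * Complex 0 1 = (-1)%:C) ?rpRr; last first.
  by apply/eqP; rewrite eq_complex /=; apply/andP; split; apply/eqP; ring.
by case: z => a b /=; apply/andP; split; apply/eqP; ring.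
Qed.

Lemma cipDl V (x y u : V) : cip (x + y) u = cip x u + cip y u.
Proof. by apply/eqP; rewrite eq_complex /= !rpDl !eqxx. Qed.

Lemma cipBl V (x y u : V) : cip (x - y) u = cip x u - cip y u.
Proof. by apply/eqP; rewrite eq_complex /= !rpDl !rpNl !eqxx. Qed.

Lemma cipBr V (x y u : V) : cip u (x - y) = cip u x - cip u y.
Proof. by apply/eqP; rewrite eq_complex /= scalerBr !rpDr !rpNr !eqxx. Qed.

Lemma cip_adj V W (f : op V W) x y : cip x (adj f y) = cip (f x) y.
Proof. by apply/eqP; rewrite eq_complex /= -opfZ -!adjP !eqxx. Qed.

Lemma cabs_cip V (x y : V) : cabs (cip x y) <= 2 * (nm x * nm y).
Proof.
apply: (le_trans (cabs_le_ReIm _)) => /=.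
have h1 := abs_cauchy_schwarz x y; have := abs_cauchy_schwarz x (Complex 0 1 *: y).
rewrite nmZ (_ : cabs (Complex 0 1) = 1) ?mul1r; first lra.
by rewrite /cabs /= expr0n expr1n add0r sqrtr1.
Qed.

(* Stampfli-Wadhwa: [<f z, x>] is an entire function of [z] vanishing at infinity,
   because dominance puts [x] in the range of every [(B - z)^*]. *)
Lemma dominant_local_resolvent K (B : op K K) (f : R[i] -> K) (x : K) : dominant_op B ->
  (forall z, shift B z (f z) = x) ->
  (forall r, exists c, forall z, cabs z <= r -> nm (f z) <= c) -> x = 0.
Proof.
move=> domB fx fb.
have [b b0 Hb] := op_bound B.
have decay z : 2 * b <= cabs z -> nm (f z) * cabs z <= 2 * nm x.
  move=> zb; have h := fx z; rewrite shiftE in h.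
  have E : z *: f z = B (f z) - x by rewrite -h opprB addrC subrK.
  have := nmB (B (f z)) x; rewrite -E nmZ; have := Hb (f z).
  have := ler_wpM2r (nm_ge0 (f z)) zb; lra.
have moveB z w u : shift B z u = shift B w u + (w - z) *: u.
  by rewrite !shiftE scalerBl; vring.
pose phi z := cip (f z) x.
have ent : entire phi.
  move=> z; set M := shift B z.
  have [m m0 Hm] := domB z; rewrite /hypo_at -/M in Hm.
  have [|y|v [Mv _ dense]] := @douglas R K K (adj M) x (m * nm (f z)).
  - by rewrite mulr_ge0 ?nm_ge0.
  - rewrite adjK -(fx z) -/M rpC adjP rpC; apply: (le_trans (cauchy_schwarz _ _)).
    by rewrite mulrAC ler_wpM2r ?nm_ge0.
  exists (cip (f z) v) => e e0.
  have [c0 Hc0] := fb (cabs z + 1).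
  pose c := `|c0| + 1.
  have cp : 0 < c by rewrite /c ltr_wpDl.
  have Hc w : cabs w <= cabs z + 1 -> nm (f w) <= c.
    by move/Hc0 => h; rewrite /c; have := ler_norm c0; lra.
  have e1 : 0 < e / (8 * c) by rewrite divr_gt0 ?mulr_gt0.
  have [u Hu] := dense _ e1; rewrite adjK in Hu.
  have [w Mw] := dominant_range domB z u; rewrite -/M in Mw.
  have k0 : 0 < 4 * c * (nm w + 1) by rewrite !mulr_gt0// ltr_wpDl ?nm_ge0.
  exists (Num.min 1 (e / (4 * c * (nm w + 1)))).
    by rewrite lt_min ltr01 divr_gt0.
  move=> t; rewrite lt_min => /andP[t1 t2].
  have ft : nm (f t) <= c.
    apply: Hc; have -> : t = z + (t - z) by ring.
    apply: (le_trans (cabsD _ _)); lra.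
  have fz : nm (f z) <= c by apply: Hc; lra.
  have Mfz : M (f z) = x := fx z.
  have Mft : M (f t) = x + (t - z) *: f t by rewrite -[in RHS](fx t) -moveB.
  (* As [x = M' v] and [M (f t) - M (f z) = (t - z) f t], the difference quotient of [phi] is
     exactly [<f t, v>]. It remains to make [<f t - f z, v>] small, although [f] is not known to be
     continuous. *)
  have -> : phi t - phi z - cip (f z) v * (t - z) = (t - z) * cip (f t - f z) v.
    rewrite /phi -Mv !cip_adj Mft Mfz cipDl cipZ cipBl; ring.
  rewrite cabsM mulrC ler_wpM2r ?cabs_ge0//.
  (* Dominance enters again: [v] is close to [M u], and [M u = M' w]. Moving [M] to the left side
     produces the small factor [t - z]. *)
  have -> : cip (f t - f z) v = cip (f t - f z) (v - adj M w) + (t - z) * cip (f t) w.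
    rewrite cipBr cip_adj opfB Mft Mfz [x + _]addrC addrK cipZ; ring.
  apply: (le_trans (cabsD _ _)); rewrite cabsM.
  have a1 := cabs_cip (f t - f z) (v - adj M w); rewrite Mw in a1 *.
  have a2 := cabs_cip (f t) w.
  have a3 : nm (f t - f z) <= 2 * c by have := nmB (f t) (f z); lra.
  have a4 : nm (f t - f z) * nm (v - M u) <= 2 * c * (e / (8 * c)).
    by apply: ler_pM; rewrite ?nm_ge0// ltW.
  have a5 : 2 * c * (e / (8 * c)) = e / 4 by field; rewrite gt_eqF.
  have a6 : nm (f t) * nm w <= c * (nm w + 1).
    by apply: ler_pM; rewrite ?nm_ge0// lerDl.
  have a7 : cabs (t - z) * cabs (cip (f t) w) <=
      e / (4 * c * (nm w + 1)) * (2 * (c * (nm w + 1))).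
    by apply: ler_pM; rewrite ?cabs_ge0//; [exact: ltW|lra].
  have a8 : e / (4 * c * (nm w + 1)) * (2 * (c * (nm w + 1))) = e / 2.
    by field; rewrite !gt_eqF// ltr_wpDl ?nm_ge0.
  lra.
have van e : 0 < e -> exists r, forall z, r <= cabs z -> cabs (phi z) <= e.
  move=> e0; exists (2 * b + 4 * (nm x * nm x) / e) => z zr.
  have q0 : 0 <= 4 * (nm x * nm x) / e by rewrite divr_ge0 ?mulr_ge0 ?nm_ge0// ltW.
  have z0 : 0 < cabs z by apply: lt_le_trans zr; lra.
  have d := decay z (le_trans (ler_wpDr q0 (lexx _)) zr).
  have h1 := cabs_cip (f z) x.
  have h2 := ler_wpM2r (nm_ge0 x) d.
  have h3 : 4 * (nm x * nm x) / e <= cabs z by lra.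
  rewrite ler_pdivrMr// in h3.
  rewrite -(ler_pM2r z0).
  have := ler_wpM2r (ltW z0) h1; lra.
have phi0 := liouville ent van.
(* Since [phi] vanishes, [<x, x> = <B (f r), x>] for large real [r], and this tends to 0 with
   [f r]. *)
apply: rp_eq0; apply: (@small_eq0 R _ (2 * b * (nm x * nm x))) => [|e e0]; first exact: rp_ge0.
pose r := 2 * b + e^-1.
have r0 : 0 < r by rewrite /r addr_gt0 ?mulr_gt0 ?invr_gt0.
have cr : cabs r%:C = r by rewrite cabs_real ger0_norm ?ltW.
have d : nm (f r%:C) * r <= 2 * nm x.
  rewrite -{2}cr; apply: decay; rewrite cr /r lerDl invr_ge0 ltW//.
have := congr1 (@complex.Re R) (phi0 r%:C); rewrite /= => F0.
have E : rp x x = rp (B (f r%:C)) x.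
  by rewrite -{1}(fx r%:C) shiftE !rpE [rp (f _) x]F0; ring.
have h1 := cauchy_schwarz (B (f r%:C)) x.
have h2 := ler_wpM2r (nm_ge0 x) (Hb (f r%:C)).
have h3 : nm (f r%:C) <= 2 * nm x * e.
  rewrite -ler_pdivrMr//; apply: le_trans d.
  by rewrite ler_wpM2l ?nm_ge0// /r lerDr mulr_ge0 ?ltW.
have h4 : b * nm (f r%:C) * nm x <= b * (2 * nm x * e) * nm x.
  by rewrite ler_wpM2r ?nm_ge0// ler_wpM2l// ltW.
rewrite E; lra.
Qed.

Lemma intertwining_self_commutator G K (A : op G G) (B : op K K) (Y : op G K) (m : R) :
  0 <= m -> (forall z, hypo_at A z m) -> dominant_op B ->
  (forall x, Y (adj A x) = B (Y x)) ->
  forall x, Y (adj A (A x) - A (adj A x)) = 0.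
Proof.
move=> m0 hA domB YA x.
pose S := opB (opM (adj A) A) (opM A (adj A)).
have SE u : S u = adj A (A u) - A (adj A u) by rewrite /S opBE.
have sS : selfadj S.
  by move=> u v; rewrite !SE !rpE adjC adjP [in LHS]adjP -!adjP -!adjC !adjK.
rewrite -SE; set c := 1 + m * m.
have c0 : 0 <= c by rewrite addr_ge0// mulr_ge0.
have bS z u : `|rp (S u) u| <= c * rp (shift A z u) (shift A z u).
  have -> : rp (S u) u =
      rp (shift A z u) (shift A z u) - rp (adj (shift A z) u) (adj (shift A z) u).
    rewrite adj_shift !shiftE SE !rpE adjC.
    have -> : rp (A (adj A u)) u = rp (adj A u) (adj A u) by rewrite adjP.
    have e1 : rp (A u) (z *: u) = rp (adj A u) (Num.conj z *: u).
      by rewrite rpZr -opfZ adjP rpC.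
    have e2 : rp (z *: u) (z *: u) = rp (Num.conj z *: u) (Num.conj z *: u).
      by rewrite !rpZZ !scalerA conjCK mulrC.
    rewrite (rpC (z *: u) (A u)) (rpC (_ *: u) (adj A u)) e1 e2; ring.
  have h := hA z u; have p1 := rp_ge0 (shift A z u).
  have p2 := rp_ge0 (adj (shift A z) u).
  have := ler_pM (nm_ge0 _) (nm_ge0 _) h h.
  have -> : m * nm (shift A z u) * (m * nm (shift A z u)) =
      m * m * (nm (shift A z u) * nm (shift A z u)) by ring.
  rewrite !nm2 => h'; have p3 : 0 <= m * m * rp (shift A z u) (shift A z u).
    by rewrite !mulr_ge0.
  by rewrite ler_norml /c; apply/andP; split; lra.
(* The conjugate is there because [Y] carries [(A - conj z)' = A' - z] to [B - z]. *)
have /choice[g Hg] : forall z, exists w, adj (shift A (Num.conj z)) w = S x /\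
    nm w <= c * nm (shift A (Num.conj z) x).
  move=> z; have [|y|w [h1 h2 _]] := @douglas R G G (adj (shift A (Num.conj z))) (S x)
      (c * nm (shift A (Num.conj z) x)).
  - by rewrite mulr_ge0 ?nm_ge0.
  - by rewrite adjK rpC -mulrA; apply: form_bound.
  - by exists w.
apply: (@dominant_local_resolvent K B (fun z => Y (g z)) _ domB).
  move=> z; rewrite -(Hg z).1 adj_shift conjCK !shiftE opfB opfZ YA//.
move=> r; have [y y0 Hy] := op_bound Y; have [a a0 Ha] := op_bound A.
exists (y * (c * (a * nm x + r * nm x))) => z zr.
apply: (le_trans (Hy _)); rewrite ler_wpM2l ?(ltW y0)//.
apply: (le_trans (Hg z).2); rewrite ler_wpM2l//.
rewrite shiftE; apply: (le_trans (nmB _ _)); apply: lerD; first exact: Ha.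
rewrite nmZ ler_wpM2r ?nm_ge0//.
by rewrite /cabs conjE /= sqrrN.
Qed.

End Dominant.

(** * The normal part of [A] and the separation of its spectral subspaces *)

Section Intertwining.
Variables (R : realType).
Implicit Types (V W G H K : hilbert R).

Lemma projectorC V (P : op V V) : projector P -> projector (opB (op1 V) P).
Proof.
move=> [sP PP]; have EE x : opB (op1 V) P x = x - P x by rewrite opBE.
split; first by move=> x y; rewrite !EE !rpE sP.
by move=> x; rewrite !EE opfB PP subrr subr0.
Qed.

(** [ker Y] is invariant under [A'], so the range of [P] is invariant under [A]; invariance under
    [A'] is the difficulty. The vanishing of [Y] on self-commutators is used for [A], giving
    [A' A P = A A' P], and again for the compression [A P], giving [P A' A P = A P A']. For
    [d = A' P x] both [|d|^2] and [|P d|^2] then equal [|A P x|^2], so [d = P d]. The normal part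
    [N] acts on the whole of [G], being zero on [ker P], so no operator on a subspace is needed. *)
Lemma normal_reduction G K (A : op G G) (B : op K K) (Y : op G K) (m : R) :
  0 <= m -> (forall z, hypo_at A z m) -> dominant_op B ->
  (forall x, Y (adj A x) = B (Y x)) ->
  exists P N : op G G, [/\ projector P, forall x, Y (P x) = Y x, forall x, Y x = 0 -> P x = 0,
    normal N & [/\ forall x, adj A (P x) = N x, forall x, P (N x) = N x, forall x, N (P x) = N x &
               commutes P (adj N)]].
Proof.
move=> m0 hA domB YA.
have [P [pP YP YP0]] := coker_projector Y; have [sP PP] := pP.
have PA x : P (adj A x) = P (adj A (P x)).
  apply/eqP; rewrite -subr_eq0 -!opfB; apply/eqP/YP0.
  by rewrite YA opfB YP subrr opf0.
have AP x : A (P x) = P (A (P x)).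
  by apply: rp_ext => u; rewrite -adjC -sP PA sP adjC sP.
have comm1 x : adj A (A (P x)) = A (adj A (P x)).
  have YS := intertwining_self_commutator m0 hA domB YA.
  apply/eqP; rewrite -subr_eq0; apply/eqP; apply: rp_ext => u; rewrite rp0r.
  have : P (adj A (A u) - A (adj A u)) = 0 by apply: YP0; apply: YS.
  move/(congr1 (fun v => rp v x)); rewrite rp0l sP => <-.
  rewrite !rpDl !rpNl !rpDr !rpNr adjC [rp (A (adj A u)) _]adjP adjC.
  by rewrite -[rp u (adj A _)]adjP.
pose A' := opM A P.
have A'xE x : A' x = A (P x) by [].
have A'E x : adj A' x = P (adj A x).
  by rewrite /A' adjM; apply: adj_eq.
(* Split along [P]: hyponormality of [A] bounds one component by [m |P w|], and on the other [A P]
   vanishes, leaving [|z| |x - P x| = |w - P w|]. *)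
have hA' z : hypo_at A' z (m + 1).
  move=> x; rewrite adj_shift !shiftE A'E.
  set w := A' x - z *: x.
  have Pw : P w = shift A z (P x) by rewrite /w A'xE opfB opfZ -AP shiftE.
  have -> : P (adj A x) - Num.conj z *: x =
     P (adj (shift A z) (P x)) - Num.conj z *: (x - P x).
    by rewrite adj_shift shiftE opfB opfZ PP -PA scalerBr; vring.
  apply: (le_trans (nmB _ _)); rewrite mulrDl mul1r; apply: lerD.
    apply: (le_trans (projector_nm _ pP)); apply: (le_trans (hA z _)).
    by rewrite -Pw ler_wpM2l// projector_nm.
  rewrite nmZ (_ : cabs (Num.conj z) = cabs (- z)); last first.
    by rewrite cabsN /cabs conjE /= sqrrN.
  rewrite -nmZ.
  have -> : - z *: (x - P x) = opB (op1 G) P w.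
    by rewrite opBE Pw shiftE /w A'xE scalerBr !scaleNr; vring.
  by apply: projector_nm; exact: projectorC.
have YA' x : Y (adj A' x) = B (Y x) by rewrite A'E YP YA.
have comm2 x : P (adj A (A (P x))) = A (P (adj A x)).
  have m1 : 0 <= m + 1 by rewrite addr_ge0.
  have := YP0 _ (intertwining_self_commutator m1 hA' domB YA' x).
  rewrite opfB !A'E !A'xE !PP -AP => /eqP; rewrite subr_eq0 => /eqP.
  by [].
have AsP x : adj A (P x) = P (adj A (P x)).
  apply/eqP; rewrite -subr_eq0; apply/eqP/rp_eq0.
  set d := adj A (P x).
  have -> : rp (d - P d) (d - P d) = rp d d - rp (P d) d.
    by rewrite !rpE (rpC d (P d)) [rp (P d) (P d)]sP PP (rpC d (P d)); ring.
  have -> : rp d d = rp (A (P x)) (A (P x)) by rewrite {2}/d -adjP /d -comm1 adjC.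
  have -> : rp (P d) d = rp (A (P x)) (A (P x)).
    by rewrite {2}/d -adjP /d -comm2 PP sP PP adjC.
  by rewrite subrr.
pose N := opM (adj A) P.
have NE x : N x = adj A (P x) by [].
have NsE x : adj N x = A (P x).
  have -> : adj N x = P (A x) by rewrite /N adjM adjK; apply: adj_eq.
  apply: rp_ext => u; rewrite -sP -adjC AsP sP adjC sP.
  by rewrite -AP.
exists P, N; split => //.
- by move=> x; rewrite NsE !NE NsE AP -AsP -AP -comm1 -AP.
- by split => // x; rewrite ?NE ?NsE -?AsP ?PP// -AP.
Qed.

(* The closed span of the ranges of [X V], for [X] in the commutant of [T], taken as a
   double orthogonal complement. *)
Lemma double_complement G H (T : op H H) (V : op G H) (g0 : G) (k : H) : V g0 <> 0 -> k <> 0 ->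
  (forall X : op H H, commutes X T -> forall g, rp (X (V g)) k = 0) ->
  exists S : H -> Prop, nontrivial_subspace S /\ hyperinvariant (@hip R H) T S.
Proof.
move=> Vg k0 orth.
pose annih k := forall X : op H H, commutes X T -> forall g, rp (X (V g)) k = 0.
exists (fun h => forall k, annih k -> rp h k = 0); split; first split.
- exists (V g0); split => // k' Hk'; exact: (Hk' (op1 H) (fun x => erefl)).
- exists k => Sk; apply: k0; apply: rp_eq0; exact: Sk.
split; first split.
- by move=> k' _; rewrite rp0l.
- move=> a x y Sx Sy k' Hk'; rewrite rpDl Sy// addr0 rpZZ Sx// => X XT g.
  by rewrite rpZr conjCK -!opfZ Hk'.
- move=> u l Su ul k' Hk'; apply/eqP; rewrite -normr_eq0; apply/eqP.
  apply: (@small_eq0 R _ (nm k')) => // e e0; have [N HN] := ul e e0.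
  have -> : rp l k' = - rp (u N - l) k' by rewrite rpDl rpNl (Su N k')// add0r opprK.
  rewrite normrN; apply: (le_trans (abs_cauchy_schwarz _ _)).
  rewrite mulrC ler_wpM2l ?nm_ge0// ltW//; exact: HN.
- move=> X bX XT x Sx k' Hk'.
  pose X' : op H H := mkop bX.
  rewrite -[X x]/(X' x) adjP; apply: Sx => Z ZT g.
  rewrite -adjP; apply: (Hk' (opM X' Z)) => v /=.
  by rewrite ZT XT.
Qed.

Lemma eigenspace_hyperinvariant H (T : op H H) (lam : R[i]) (h : H) :
  h <> 0 -> T h = lam *: h -> ~ (forall x, T x = lam *: x) ->
  exists S : H -> Prop, nontrivial_subspace S /\ hyperinvariant (@hip R H) T S.
Proof.
move=> h0 Th nonsc; exists (fun x => T x = lam *: x); split; first split.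
- by exists h.
- by apply/existsNP.
split; first split.
- by rewrite opf0 scaler0.
- by move=> a x y Tx Ty; rewrite opfD opfZ Tx Ty scalerDr !scalerA mulrC.
- move=> u l Su ul; apply/eqP; rewrite -subr_eq0 -shiftE; apply/eqP.
  have [c c0 Hc] := op_bound (shift T lam).
  apply: (@nm_small_eq0 _ _ _ c) => e e0; have [N HN] := ul e e0.
  have -> : shift T lam l = - shift T lam (u N - l).
    by rewrite opfB (shiftE T lam (u N)) Su subrr sub0r opprK.
  rewrite nmN; apply: (le_trans (Hc _)); rewrite ler_pM2l// ltW//; exact: HN.
- move=> X bX XT x Tx; rewrite -XT Tx.
  exact: (opfZ (mkop (bX : bounded_linear (X : H -> H)))).
Qed.

(** A lower bound for [D'] on the range of [E] becomes, by Douglas' lemma, solvability of [D w = x]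
    for [x] in that range. *)
Lemma coercive_range V (D E : op V V) (d : R) : projector E -> 0 < d ->
  (forall y, E (adj D y) = adj D (E y)) ->
  (forall y, d * nm (E y) <= nm (adj D (E y))) ->
  forall x, E x = x -> exists w, D w = x.
Proof.
move=> pE d0 ED H x Ex; have [sE EE] := pE.
have [|y|w [Dw _ _]] := @douglas R V V D x (d^-1 * nm x).
- by rewrite mulr_ge0 ?nm_ge0// invr_ge0 ltW.
- have h : nm (E y) <= d^-1 * nm (adj D y).
    by rewrite ler_pdivlMl//; apply: (le_trans (H y)); rewrite -ED projector_nm.
  rewrite -{1}Ex -sE; apply: (le_trans (cauchy_schwarz _ _)).
  by apply: (le_trans (ler_wpM2r (nm_ge0 x) h)); rewrite mulrAC.
by exists w.
Qed.

Lemma coercive_bound V (D : op V V) (w : R[i]) (d : R) (x : V) : cabs w = 1 ->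
  d * rp x x <= rp (w *: D x) x -> d * nm x <= nm (D x) /\ d * nm x <= nm (adj D x).
Proof.
move=> w1 H.
have key (y : V) : d * rp x x <= nm y * nm x -> d * nm x <= nm y.
  have [->|/eqP x0] := eqVneq x 0; first by move=> _; rewrite nm0 mulr0 nm_ge0.
  by rewrite -nm2 mulrA ler_pM2r ?nm_gt0.
split; apply: key; apply: (le_trans H).
  by apply: (le_trans (cauchy_schwarz _ _)); rewrite nmZ w1 mul1r.
rewrite rpZZ adjP opfZ; apply: (le_trans (cauchy_schwarz _ _)).
by rewrite nmZ /cabs conjE /= sqrrN -/(cabs w) w1 mul1r mulrC.
Qed.

Lemma spectrally_separated G K (N : op G G) (B : op K K) (Y Y' : op G K) (E F : op G G)
    (w : R[i]) (c1 c2 : R) : cabs w = 1 -> c1 < c2 ->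
  normal N -> dominant_op B ->
  (forall x, Y (N x) = B (Y x)) -> (forall x, Y' (N x) = B (Y' x)) ->
  projector E -> commutes E N -> commutes E (adj N) ->
  projector F -> commutes F N -> commutes F (adj N) ->
  (forall x, rp (w *: N (E x)) (E x) <= c1 * rp (E x) (E x)) ->
  (forall x, c2 * rp (F x) (F x) <= rp (w *: N (F x)) (F x)) ->
  forall g g', rp (Y (E g)) (Y' (F g')) = 0.
Proof.
move=> w1 c12 nN domB YN Y'N pE EN ENs pF FN FNs Ele Fge g g'.
have [sE EE] := pE; have [sF FF] := pF.
rewrite -[rp _ _]adjC -sF (_ : F _ = 0) ?rp0l//.
apply: (normal_range_trivial nN) => z.
have Fs y : F (adj (shift N z) y) = adj (shift N z) (F y).
  by rewrite !adj_shift !shiftE opfB opfZ FNs.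
have Ysh (Z : op G K) (ZN : forall x, Z (N x) = B (Z x)) x :
    Z (shift N z x) = shift B z (Z x) by rewrite !shiftE opfB opfZ ZN.
have wz (x : G) : rp (w *: (z *: x)) x = complex.Re (w * z) * rp x x.
  rewrite scalerA rpZl; have := rp_i x x; rewrite (rpC x (_ *: x)) => /eqP.
  by rewrite -addr_eq0 -mulr2n mulrn_eq0 /= => /eqP ->; rewrite mulr0 addr0.
(* Each [z] is at a positive distance from one of the half-planes carrying [N] on the ranges of [E]
   and [F]. If it is the one of [F], then [(N - z)'] maps onto the range of [F], where the vector
   lies; otherwise [E g] lies in the range of [N - z]. *)
have [small|big] := leP (complex.Re (w * z)) c1.
- apply: (@coercive_range G (adj (shift N z)) F (c2 - c1)) => //.
  + by rewrite subr_gt0.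
  + by move=> y; rewrite !adjK !shiftE opfB opfZ FN.
  + move=> y; rewrite adjK.
    have [] // := @coercive_bound G (shift N z) w (c2 - c1) (F y) w1.
    rewrite shiftE scalerBr rpDl rpNl wz; have := Fge y.
    have : complex.Re (w * z) * rp (F y) (F y) <= c1 * rp (F y) (F y).
      by rewrite ler_wpM2r ?rp_ge0.
    lra.
- have [||||v Ev] := @coercive_range G (shift N z) E (complex.Re (w * z) - c1) pE _ _ _ (E g).
  + by rewrite subr_gt0.
  + by move=> y; rewrite !adj_shift !shiftE opfB opfZ ENs.
  + move=> y; have [] // := @coercive_bound G (shift N z) (- w) (complex.Re (w * z) - c1) (E y).
      by rewrite cabsN.
    rewrite shiftE scaleNr scalerBr !rpNl rpDl rpNl wz; have := Ele y; lra.
  + exact: EE.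
  (* [Y E g = (B - z) Y v = (B - z)' u], and [F Y''] carries [(B - z)'] to [(N - z)'], where [Y'']
     is the adjoint of [Y']. *)
  have [u Hu] := dominant_range domB z (Y v).
  exists (F (adj Y' u)).
  rewrite -Fs -Ev Ysh// -Hu; congr (F _).
  by apply: rp_ext => x; rewrite -!adjP Ysh// adjP.
Qed.

End Intertwining.

(** * Hyperinvariant subspaces *)

Section Final.
Variables (R : realType).
Implicit Types (V W G H K : hilbert R).

(** Detects two separated pieces of spectrum from quotients of quadratic forms. Two different
    quotients leave room for the thresholds [c1 < c2], placed at the thirds of the gap. *)
Lemma ratio_dichotomy (I : Type) (q s : I -> R) : (forall i, 0 <= s i) ->
  (forall i, s i = 0 -> q i = 0) ->
  (exists c, forall i, q i = c * s i) \/
  (exists c1 c2 i j, [/\ c1 < c2, q i < c1 * s i & c2 * s j < q j]).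
Proof.
move=> s0 q0; have [[i0 si0]|none] := pselect (exists i, s i <> 0); last first.
  left; exists 0 => i; rewrite mul0r q0//; apply: contrapT => si.
  by apply: none; exists i.
have pos i : s i <> 0 -> 0 < s i by move=> /eqP si; rewrite lt_neqAle eq_sym si s0.
have [[i /eqP ne]|all] := pselect (exists i, q i <> q i0 / s i0 * s i); last first.
  left; exists (q i0 / s i0) => i; apply: contrapT => ne; apply: all; by exists i.
right.
have si : s i <> 0 by move=> si; move: ne; rewrite si q0// mulr0 eqxx.
have p0 := pos _ si0; have p := pos _ si.
have key k j (pk : 0 < s k) (pj : 0 < s j) : q k / s k < q j / s j ->
    exists c1 c2 i j, [/\ c1 < c2, q i < c1 * s i & c2 * s j < q j].
  move=> lt; exists ((2 * (q k / s k) + q j / s j) / 3), ((q k / s k + 2 * (q j / s j)) / 3), k, j.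
  split; first by lra.
  - by rewrite -ltr_pdivrMr//; lra.
  - by rewrite -ltr_pdivlMr//; lra.
have : q i / s i != q i0 / s i0.
  by apply: contra ne => /eqP <-; rewrite divfK// gt_eqF.
by rewrite neq_lt => /orP[]; exact: key.
Qed.

(** The two hypotheses say that the complex form [<D x, x>] is zero. The polarization identities of
    [D] and [i D], taken together, give [D = 0]. *)
Lemma quadratic_zero V (D : op V V) : (forall x, rp (D x) x = 0) ->
  (forall x, rp (Complex 0 1 *: D x) x = 0) -> forall x, D x = 0.
Proof.
move=> D0 iD0 x; apply: rp_ext => y; rewrite rp0r.
have pol (E : op V V) u v : (forall x, rp (E x) x = 0) -> rp (E u) v = - rp (E v) u.
  move=> E0; have := E0 (u + v); rewrite opfD !rpE !E0; lra.
have h1 := pol D (Complex 0 1 *: x) (Complex 0 1 *: y) D0.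
have h2 := pol (opZ (Complex 0 1) D) x (Complex 0 1 *: y) iD0.
have h3 := rp_i (D (Complex 0 1 *: y)) x.
have h4 : rp (D x) y = rp (Complex 0 1 *: D x) (Complex 0 1 *: y).
  rewrite rpZZ scalerA (_ : _ * _ = 1) ?scale1r// conjE.
  by apply/eqP; rewrite eq_complex /=; apply/andP; split; apply/eqP; ring.
rewrite rpC h4; move: h1 h2 h3; rewrite (opfZ D) /=.
set a := rp _ (Complex 0 1 *: y).
rewrite -/a; lra.
Qed.

Lemma operator_theorem G H K (A : op G G) (B : op K K) (T : op H H) (W1 : op G H) (W2 : op H K)
    (m : R) : 0 <= m -> (forall z, hypo_at A z m) -> dominant_op B ->
  (exists x, W1 x <> 0) -> (exists x, W2 x <> 0) ->
  (forall x, W1 (adj A x) = T (W1 x)) -> (forall x, W2 (T x) = B (W2 x)) ->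
  (forall lam : R[i], ~ (forall x, T x = lam *: x)) ->
  exists S : H -> Prop, nontrivial_subspace S /\ hyperinvariant (@hip R H) T S.
Proof.
move=> m0 hA domB [g1 W1g] [h1 W2h] W1A W2T nonsc.
have adj_nz (W : hilbert R) (Q : op H W) h : Q h <> 0 -> adj Q (Q h) <> 0.
  move=> Qh a0; apply: Qh; apply: rp_eq0; by rewrite adjP a0 rp0r.
have [[X0 [X0T [g2 Y0]]]|none] :=
    pselect (exists X : op H H, commutes X T /\ exists g, W2 (X (W1 g)) <> 0); last first.
  apply: (@double_complement R G H T W1 g1 (adj W2 (W2 h1))) => //; first exact: adj_nz.
  move=> X XT g; rewrite -adjP (_ : W2 _ = 0) ?rp0l//; apply: contrapT => ne.
  by apply: none; exists X; split => //; exists g.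
pose Y := opM W2 (opM X0 W1).
have YE x : Y x = W2 (X0 (W1 x)) by [].
have YA x : Y (adj A x) = B (Y x) by rewrite !YE W1A X0T W2T.
have [P [N [[sP PP] YP YP0 nN [AsP PN NP PNs]]]] := normal_reduction m0 hA domB YA.
have PNc : commutes P N by move=> x; rewrite PN NP.
pose V := opM W1 P.
have VE x : V x = W1 (P x) by [].
have TV x : T (V x) = V (N x) by rewrite !VE PN -W1A AsP.
have YV (X : op H H) x : commutes X T -> W2 (X (V (N x))) = B (W2 (X (V x))).
  by move=> XT; rewrite -TV XT W2T.
have YVE x : W2 (X0 (V x)) = Y x by rewrite VE -YE YP.
have split_case (w : R[i]) : cabs w = 1 ->
    (exists c1 c2 x y, [/\ c1 < c2, rp (w *: N (P x)) (P x) < c1 * rp (P x) (P x) &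
                        c2 * rp (P y) (P y) < rp (w *: N (P y)) (P y)]) ->
    exists S : H -> Prop, nontrivial_subspace S /\ hyperinvariant (@hip R H) T S.
  move=> w1 [c1 [c2 [x [y [c12 qx qy]]]]].
  pose S := opZ (1/2)%:C (opD (opZ w N) (adj (opZ w N))).
  have SE u : S u = (1/2)%:C *: (w *: N u + adj (opZ w N) u) by [].
  have adjw u : adj (opZ w N) u = Num.conj w *: adj N u.
    apply: (adj_eq (g := opZ (Num.conj w) (adj N))) => a b /=.
    by rewrite rpZZ adjP opfZ.
  have sS : selfadj S.
    by move=> u v; rewrite !SE !rpE adjC -[w *: N u]/(opZ w N u) adjP; ring.
  have Sq u : rp (S u) u = rp (w *: N u) u.
    by rewrite SE !rpE adjC /= (rpC u); field.
  have comm (Z : op G G) : commutes Z N -> commutes Z (adj N) -> commutes Z S.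
    by move=> ZN ZNs u; rewrite !SE !adjw opfZ opfD !opfZ ZN ZNs.
  have NS : commutes N S by apply: comm => //.
  have NsS : commutes (adj N) S by apply: comm => // u; rewrite nN.
  have PS : commutes P S by apply: comm.
  have [E [pE Ele Ege Ec]] := spectral_projector c1 sS.
  have [F [[sF FF] Fle Fge Fc]] := spectral_projector c2 sS.
  pose F' := opB (op1 G) F.
  have F'E u : F' u = u - F u by rewrite /F' opBE.
  have pF' : projector F' by exact: projectorC.
  have PE u : P (E u) = E (P u) := Ec _ PS u.
  have PF' u : P (F' u) = F' (P u) by rewrite !F'E opfB (Fc _ PS).
  (* The strict inequalities for [x] and [y] exclude that [P x] lies in the kernel of [E], or [P y]
     in that of [F']. *)
  have Ex : E (P x) <> 0.
    move=> E0; have := Ege _ E0; rewrite Sq; lra.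
  have Fy : F' (P y) <> 0.
    rewrite F'E => /eqP; rewrite subr_eq0 => /eqP Py.
    have := Fle (P y); rewrite -Py Sq; lra.
  have YF : Y (F' (P y)) <> 0 by move/YP0; rewrite PF' PP.
  (* The span starts from the range of [W1 P E]; the vector orthogonal to it comes from the other
     spectral piece. *)
  apply: (@double_complement R G H T (opM V E) (P x) (adj W2 (Y (F' (P y))))).
  - move=> V0; have : Y (E (P x)) = 0 by rewrite -YVE (V0 : V (E (P x)) = 0) !opf0.
    by move/YP0; rewrite PE PP.
  - by rewrite -YVE; apply: adj_nz; rewrite YVE.
  - move=> X XT g; rewrite -adjP /=.
    apply: (@spectrally_separated R G K N B (opM W2 (opM X V)) Y E F' w c1 c2) => //.
    + by move=> u /=; apply: YV.
    + by move=> u; rewrite -!YVE; apply: YV.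
    + by move=> u; rewrite Ec.
    + by move=> u; rewrite Ec.
    + by move=> u; rewrite !F'E opfB Fc.
    + by move=> u; rewrite !F'E opfB Fc.
    + by move=> u; rewrite -Sq; exact: Ele.
    + move=> u; rewrite -Sq; apply: Fge.
      by rewrite F'E opfB FF subrr.
have dich (w : R[i]) := @ratio_dichotomy G (fun x => rp (w *: N (P x)) (P x))
  (fun x => rp (P x) (P x)) (fun x => rp_ge0 _).
have c1 : cabs (1 : R[i]) = 1 by rewrite /cabs /= expr0n expr1n addr0 sqrtr1.
have ci : cabs (Complex 0 1 : R[i]) = 1 by rewrite /cabs /= expr0n expr1n add0r sqrtr1.
have zero (w : R[i]) x : rp (P x) (P x) = 0 -> rp (w *: N (P x)) (P x) = 0.
  by move/rp_eq0 => ->; rewrite rp0r.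
(* The directions [w = 1] and [w = i] suffice: if neither separates, the real and imaginary parts of
   [N] are both scalar on the range of [P]. *)
have [[a Ha]|] := dich 1 (zero 1); last exact: split_case.
have [[b Hb]|] := dich (Complex 0 1) (zero _); last exact: split_case.
(* The sign comes from [Re (i z) = - Im z]. *)
pose lam := Complex a (- b).
have ii (x : G) : rp (Complex 0 1 *: x) x = 0.
  have := rp_i x x; rewrite (rpC x (_ *: x)); lra.
have NPl x : N x = lam *: P x.
  apply/eqP; rewrite -subr_eq0; apply/eqP.
  pose D := opB N (opZ lam P).
  have DE u : D u = N u - lam *: P u by rewrite /D opBE.
  have DP (w : R[i]) u : rp (w *: D u) u = rp (w *: N (P u)) (P u) - rp (w *: (lam *: P u)) (P u).
    by rewrite DE scalerBr rpDl rpNl NP -[in RHS]sP -[in RHS]sP !opfZ PN PP.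
  rewrite -DE; apply: quadratic_zero => u.
    rewrite -[D u]scale1r DP Ha scale1r rpZl ii /lam /=; ring.
  by rewrite DP Hb scalerA rpZl ii /lam /=; ring.
apply: (@eigenspace_hyperinvariant R H T lam (V g2)) => //.
- by move=> V0; apply: Y0; rewrite -YE -YVE V0 !opf0.
- by rewrite TV NPl !VE opfZ PP opfZ.
Qed.

End Final.

Lemma hipE (R : realType) (V : hilbert R) (x y : V) : hip x y = cip x y.
Proof.
have [[_ Z C _ _] _ _] := hilbertP V.
rewrite /cip /rp (C (Complex 0 1 *: y)) Z (C x y) conjE.
by case: (hip x y) => p q; apply/eqP; rewrite eq_complex /=; apply/andP; split; apply/eqP; ring.
Qed.

Theorem theorem3p1 (R : realType)
  (G : lmodType R[i]) (ipG : G -> G -> R[i])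
  (H : lmodType R[i]) (ipH : H -> H -> R[i])
  (K : lmodType R[i]) (ipK : K -> K -> R[i])
  (hG : is_hilbert ipG) (hH : is_hilbert ipH) (hK : is_hilbert ipK)
  (A As : G -> G) (B : K -> K) (T : H -> H) (W1 : G -> H) (W2 : H -> K)
  (M : R)
  (bA : bounded_op ipG ipG A) (adjA : is_adjoint ipG ipG A As)
  (bB : bounded_op ipK ipK B) (bT : bounded_op ipH ipH T)
  (bW1 : bounded_op ipG ipH W1) (bW2 : bounded_op ipH ipK W2)
  (M_pos : 0 < M) (hypA : M_hyponormal ipG A M) (domB : dominant ipK B)
  (W1_nz : exists x, W1 x <> 0) (W2_nz : exists x, W2 x <> 0)
  (int1 : forall x, W1 (As x) = T (W1 x))
  (int2 : forall x, W2 (T x) = B (W2 x))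
  (T_nonscalar : forall lam : R[i], ~ (forall x, T x = lam *: x)) :
  exists S : H -> Prop, nontrivial_subspace S /\ hyperinvariant ipH T S.
Proof.
pose GG := Hilbert hG; pose HH := Hilbert hH; pose KK := Hilbert hK.
pose A' : op GG GG := @mkop R GG GG A bA.
pose B' : op KK KK := @mkop R KK KK B bB.
pose T' : op HH HH := @mkop R HH HH T bT.
pose W1' : op GG HH := @mkop R GG HH W1 bW1.
pose W2' : op HH KK := @mkop R HH KK W2 bW2.
have isadj (V : hilbert R) (D : op V V) : is_adjoint (@hip R V) (@hip R V) D (adj D).
  by move=> x y; rewrite !hipE cip_adj.
have AsE x : adj A' x = As x.
  apply/rp_ext => u; rewrite -adjP /rp.
  by rewrite -[hip u (As x)]/(ipG u (As x)) -adjA.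
apply: (@operator_theorem R GG HH KK A' B' T' W1' W2' (Num.sqrt M) (sqrtr_ge0 M)) => //.
- move=> z x; rewrite adj_shift !shiftE; exact: (hypA _ (isadj GG A') z x).
- move=> z; have [Ml HMl] := domB _ (isadj KK B') z.
  exists (Num.sqrt Ml); first exact: sqrtr_ge0.
  by move=> x; rewrite adj_shift !shiftE; exact: HMl.
- by move=> x; rewrite AsE; exact: int1.
Qed.
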